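(* Let $\mathcal{T}$ be a self-affine tiling of $\mathbb{R}^d$ with expansion map $Q$ and a primitive substitution rule $\omega$ with finite local complexity. Suppose there exist a tile $T_0\in\mathcal{T}$ and a lattice $L$ of $\mathbb{R}^d$ such that $\{T_0+v: v\in L\}\subset\mathcal{T}$ and $Q(L)\subset L$. Then the tiling dynamical system $(X_{\mathcal{T}},\mu,\mathbb{R}^d)$ has pure discrete spectrum.
   Context: A tile in $\mathbb{R}^d$ is a compact set equal to the closure of its interior, possibly carrying a label from a fixed finite set; $T+x$ is its translate. A patch is a set of tiles any two distinct members of which have disjoint interiors; its support is the closure of the union of the supports; a tiling is a patch with support $\mathbb{R}^d$. For a patch $\mathcal{P}$ and $S\subset\mathbb{R}^d$, $\mathcal{P}\sqcap S=\{T\in\mathcal{P}:\operatorname{supp}T\cap S\neq\emptyset\}$. A tiling has finite local complexity (FLC) if for each compact $K$ the set $\{\mathcal{T}\sqcap(K+x)\}_x$ is finite up to translation; it is repetitive if for every finite patch $\mathcal{P}$ with $\mathcal{P}+y\subset\mathcal{T}$ for some $y$ there is $R>0$ such that every ball of radius $R$ contains the support of some translate $\mathcal{P}+x\subset\mathcal{T}$. A substitution rule consists of a finite set $\mathcal{A}$ of prototiles, a linear expansion map $Q$ (all eigenvalues of modulus $>1$) and a map $\omega$ assigning to each $P\in\mathcal{A}$ a finite patch of translates of prototiles with $\operatorname{supp}\omega(P)=Q(\operatorname{supp}P)$, extended by $\omega(P+x)=\omega(P)+Qx$ and unions; it is primitive if some power of its substitution matrix (entry $(i,j)$ = number of translates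 of the $i$-th prototile in $\omega$ of the $j$-th) is positive, and has FLC if for each compact $K$ the set $\{\omega^n(P)\sqcap(K+x)\}_{n>0,P,x}$ is finite up to translation. A self-affine tiling for $\omega$ is a tiling $\mathcal{T}$ of translates of prototiles with $\omega(\mathcal{T})=\mathcal{T}$, having FLC and being repetitive. The hull $X_{\mathcal{T}}$ is the closure of $\{\mathcal{T}+x:x\in\mathbb{R}^d\}$ in the local matching topology (patches are close if, after translating each by a small vector, they agree on a large ball around the origin); $\mathbb{R}^d$ acts on it by translation, and $\mu$ is its unique translation-invariant Borel probability measure. A vector $a$ is an eigenvalue if there is a nonzero $f\in L^2(\mu)$ with $f(\mathcal{S}-x)=e^{2\pi i\langle x,a\rangle}f(\mathcal{S})$ for $\mu$-a.e. $\mathcal{S}$, for each $x$; the system has pure discrete spectrum if $L^2(\mu)$ has an orthonormal basis of eigenfunctions. *)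

(* Defs.v *)
(* MathComp + MathComp-Analysis (R : realType), complex numbers from
   mathcomp-real-closed (R[i] = complex R). *)
From HB Require Import structures.
From mathcomp Require Import all_boot all_order all_algebra finmap.
From mathcomp Require Import all_classical all_reals all_analysis.
From mathcomp Require Import complex.
Import Order.TTheory GRing.Theory Num.Theory numFieldNormedType.Exports.

Set Implicit Arguments.
Unset Strict Implicit.
Unset Printing Implicit Defensive.

Local Open Scope classical_set_scope.
Local Open Scope ring_scope.

Section Tilings.
Variables (R : realType) (d : nat) (Lab : finType).
Local Notation V := 'rV[R]_d.

(* ---------- Euclidean geometry of R^d (row vectors) ---------- *)
Definition dotv (x y : V) : R := \sum_(i < d) x ord0 i * y ord0 i.
Definition sqnorm (x : V) : R := dotv x x.
(* open Euclidean ball *)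
Definition eball (c : V) (r : R) : set V := [set y | sqnorm (y - c) < r ^+ 2].
(* translate of a subset of R^d *)
Definition vtr (K : set V) (x : V) : set V := (fun y => y + x) @` K.
(* the linear map x |-> Q x, with Q acting on row vectors *)
Definition lin (Q : 'M[R]_d) (x : V) : V := x *m Q.

(* ---------- tiles, patches, tilings ---------- *)
(* a (possibly labelled) tile: its support and its label *)
Record tile := Tile { tsupp : set V ; tlab : Lab }.

Definition is_tile (T : tile) : Prop :=
  compact (tsupp T) /\ tsupp T = closure (interior (tsupp T)).

(* T + x *)
Definition tr (T : tile) (x : V) : tile := Tile (vtr (tsupp T) x) (tlab T).
(* P + x for a patch P *)
Definition ptr (P : set tile) (x : V) : set tile := (fun T => tr T x) @` P.

Definition is_patch (P : set tile) : Prop :=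
  (forall T, P T -> is_tile T) /\
  (forall T T', P T -> P T' -> T <> T' ->
     interior (tsupp T) `&` interior (tsupp T') = set0).

Definition psupp (P : set tile) : set V := closure (\bigcup_(T in P) tsupp T).

Definition is_tiling (P : set tile) : Prop := is_patch P /\ psupp P = setT.

(* P ⊓ S *)
Definition pcap (P : set tile) (S : set V) : set tile :=
  [set T | P T /\ tsupp T `&` S !=set0].

(* a family of patches is finite up to translation *)
Definition fin_up_to_tr (F : set (set tile)) : Prop :=
  exists (n : nat) (G : 'I_n -> set tile),
    forall P, F P -> exists (j : 'I_n) (x : V), P = ptr (G j) x.

Definition tiling_FLC (T : set tile) : Prop :=
  forall K : set V, compact K ->
    fin_up_to_tr [set Pt | exists x : V, Pt = pcap T (vtr K x)].

Definition repetitive (T : set tile) : Prop :=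
  forall P : set tile, finite_set P -> (exists y, ptr P y `<=` T) ->
    exists r : R, 0 < r /\
      forall c : V, exists x : V, ptr P x `<=` T /\ psupp (ptr P x) `<=` eball c r.

(* ---------- substitution rules ---------- *)
(* prototiles P : 'I_m -> tile, expansion Q, omega i = ω(P i) *)
Section Subst.
Variables (m : nat) (P : 'I_m -> tile) (Q : 'M[R]_d) (omega : 'I_m -> set tile).

(* all (complex) eigenvalues of Q have modulus > 1 *)
Definition expansion_map : Prop :=
  forall z : R[i], root (map_poly (fun r : R => Complex r 0) (char_poly Q)) z ->
    1 < `|z|.

Definition subst_rule : Prop :=
  injective P /\ (forall i, is_tile (P i)) /\ expansion_map /\
  forall i, [/\ is_patch (omega i), finite_set (omega i),
               (forall T, omega i T -> exists j x, T = tr (P j) x) &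
               psupp (omega i) = lin Q @` tsupp (P i)].

(* ω(P i + x) = ω(P i) + Q x, extended to patches by unions *)
Definition subst_tile (T : tile) : set tile :=
  [set T' | exists (i : 'I_m) (x : V), T = tr (P i) x /\ ptr (omega i) (lin Q x) T'].
Definition subst (S : set tile) : set tile := \bigcup_(T in S) subst_tile T.

(* substitution matrix: entry (i,j) = number of translates of P i in ω(P j) *)
Definition subst_matrix : 'M[R]_m :=
  \matrix_(i < m, j < m) (#|` fset_set [set x : V | omega j (tr (P i) x)] |)%fset%:R.

Definition mxpow (A : 'M[R]_m) (k : nat) : 'M[R]_m := iter k (fun B => B *m A) 1%:M.

Definition primitive : Prop :=
  exists k : nat, (0 < k)%N /\ forall i j, 0 < mxpow subst_matrix k i j.

Definition subst_FLC : Prop :=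
  forall K : set V, compact K ->
    fin_up_to_tr [set Pt | exists (n : nat) (i : 'I_m) (x : V),
                    (0 < n)%N /\ Pt = pcap (iter n subst [set P i]) (vtr K x)].

Definition self_affine_tiling (T : set tile) : Prop :=
  [/\ is_tiling T, (forall S, T S -> exists i x, S = tr (P i) x),
      subst T = T, tiling_FLC T & repetitive T].
End Subst.

(* ---------- lattices ---------- *)
Definition is_lattice (L : set V) : Prop :=
  exists B : 'M[R]_d, B \in unitmx /\
    L = [set v | exists n : 'rV[int]_d, v = map_mx (fun z : int => z%:~R) n *m B].

(* ---------- the hull and its measurable structure ---------- *)
(* S and S' are eps-close in the local matching sense: after translating
   each by a vector of length < eps, they agree on the ball B(0, 1/eps) *)
Definition lm_close (eps : R) (S S' : set tile) : Prop :=
  exists x y : V, sqnorm x < eps ^+ 2 /\ sqnorm y < eps ^+ 2 /\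
    pcap (ptr S x) (eball 0 eps^-1) = pcap (ptr S' y) (eball 0 eps^-1).

(* closure of the translation orbit of T in the local matching topology *)
Definition hull (T : set tile) : set (set tile) :=
  [set S | forall eps : R, 0 < eps -> exists x : V, lm_close eps S (ptr T x)].

(* open subsets of the hull (local matching topology) *)
Definition hull_open (T : set tile) : set (set (set tile)) :=
  [set U | U `<=` hull T /\
     forall S, U S -> exists2 eps : R, 0 < eps &
       [set S' | hull T S' /\ lm_close eps S S'] `<=` U].

(* the hull with its Borel sigma-algebra (points outside the hull form a
   measurable set which the measures below give mass 0) *)
Definition hullSpace (T : set tile) := g_sigma_algebraType (hull_open T).

(* ---------- spectral notions ---------- *)
Section Spectrum.
Variables (T : set tile) (mu : {measure set (hullSpace T) -> \bar R}).
Local Notation X := (hullSpace T).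

Definition shift (x : V) (S : X) : X := ptr S x.

Definition translation_invariant : Prop :=
  forall (x : V) (A : set X), measurable A -> mu (shift x @^-1` A) = mu A.

Definition cnorm2 (z : R[i]) : R := complex.Re z ^+ 2 + complex.Im z ^+ 2.

(* f is (a representative of) an element of L^2(mu; C) *)
Definition isL2 (f : X -> R[i]) : Prop :=
  measurable_fun setT (fun S => complex.Re (f S)) /\
  measurable_fun setT (fun S => complex.Im (f S)) /\
  (\int[mu]_S (cnorm2 (f S))%:E < +oo)%E.

Definition expi (t : R) : R[i] := Complex (cos t) (sin t).

Definition eigenfunction (a : V) (f : X -> R[i]) : Prop :=
  isL2 f /\ ~ {ae mu, forall S, f S = 0} /\
  forall x : V, {ae mu, forall S,
     f (shift (- x) S) = expi (2 * pi * dotv x a) * f S}.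

Definition is_eigenvalue (a : V) : Prop := exists f, eigenfunction a f.

(* <f, g> = \int f * conj g, as real and imaginary parts *)
Definition inner_re (f g : X -> R[i]) : \bar R :=
  (\int[mu]_S (complex.Re (f S * (g S)^*)%C)%:E)%E.
Definition inner_im (f g : X -> R[i]) : \bar R :=
  (\int[mu]_S (complex.Im (f S * (g S)^*)%C)%:E)%E.

(* L^2(mu) has an orthonormal basis consisting of eigenfunctions:
   an orthonormal family of eigenfunctions whose linear span is dense *)
Definition pure_discrete_spectrum : Prop :=
  exists (I : Type) (e : I -> X -> R[i]),
    [/\ forall k, exists a : V, eigenfunction a (e k),
        forall k, inner_re (e k) (e k) = 1%E /\ inner_im (e k) (e k) = 0%E,
        forall k l, k <> l -> inner_re (e k) (e l) = 0%E /\ inner_im (e k) (e l) = 0%E &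
        forall f, isL2 f -> forall eps : R, 0 < eps ->
          exists (n : nat) (ks : 'I_n -> I) (c : 'I_n -> R[i]),
            (\int[mu]_S (cnorm2 (f S - \sum_(j < n) c j * e (ks j) S))%:E
               < eps%:E)%E].
End Spectrum.

End Tilings.

(* Main.v *)
(* Write [L_n = Q^n L]. The tiles of [T] whose [L_n]-translates all lie in [T] form an [L_n]-periodic patch [P_n], increasing with [n], with [omega(P_n)] contained in [P_(n+1)].

Eigenvalues. Let [M_n] be the set of vectors [x] with [P_n + x] contained in [T]; it is a lattice containing [L_n]. By repetitivity, the class of [w] modulo [M_n] is determined by the patch of [T + w] on a large enough ball, so every [S] in the hull has a position in [R^d / M_n], depending continuously on [S]; composing with a character of [R^d / M_n] gives a continuous eigenfunction of modulus 1.

Density. Every supertile of a large enough level [K] contains a tile of [T0 + L]. Hence a fixed proportion of each supertile of [T \ P_(jK)] is covered when passing to [P_((j+1)K)], and the upper Banach density of [T \ P_n] tends to 0. By invariance of the measure, for almost every [S] and every ball, all tiles of [S] meeting the ball belong to the copy of [P_n] in [S] for some [n]; so up to a null set an open subset of the hull is a countable union of sets defined by finitely many eigenfunctions. Since the span of the eigenfunctions is an algebra, the sets with indicator in its L^2-closure form a sigma-algebra, which therefore contains all measurable sets. *)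

Require Import Defs.
From HB Require Import structures.
From mathcomp Require Import all_boot all_order all_algebra finmap.
From mathcomp Require Import all_classical all_reals all_analysis.
From mathcomp Require Import measurable_realfun.
From mathcomp Require Import complex.
From mathcomp Require Import ring lra.
Import Order.TTheory GRing.Theory Num.Theory numFieldNormedType.Exports.

Set Implicit Arguments.
Unset Strict Implicit.
Unset Printing Implicit Defensive.

Local Open Scope classical_set_scope.
Local Open Scope ring_scope.

(** * Row vectors with the supremum norm *)

(** The patch [P_n] can have periods outside [L_n], and no local patch separates positions that
    differ by such a period; this is why positions are taken modulo [M_n]. That [M_n] is a lattice
    rests on [T0]: modulo [L_n], a vector of [M_n] moves [T0] to one of finitely many tiles of [T]
    near the origin, so [M_n / L_n] has bounded exponent. Densities are averages over finite
    families of translations instead of volumes. Translates and linear images are then immediate,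
    and an invariant probability turns a bound on such averages into a bound on a measure by
    integrating term by term. Upper densities are only subadditive, so the covered proportion cannot
    simply be subtracted; it enters through coboundaries, whose upper mean is at most 0.
    Eigenfunctions are attached to every vector [a] for which local patches determine [<w, a>]
    modulo 1, not level by level. These [a] form a group, which makes the span of the eigenfunctions
    an algebra. *)

Section RowVectors.
Variables (R : realType) (d : nat).
Local Notation V := 'rV[R]_d.

Lemma rV_norm_le (x : V) (c : R) : 0 <= c ->
  `|x| <= c <-> forall i, `|x ord0 i| <= c.
Proof.
move=> c0; rewrite [ `|x| ]mx_normrE; split=> [/bigmax_leP[_ H] i|H].
  exact: (H (ord0, i)).
by apply/bigmax_leP; split=> // -[i j] _ /=; rewrite ord1.
Qed.

Lemma rV_norm_coord (x : V) i : `|x ord0 i| <= `|x|.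
Proof. exact: (rV_norm_le x (normr_ge0 x)).1. Qed.

Lemma interiorP_norm (A : set V) x :
  interior A x <-> exists2 e, 0 < e & forall y, `|y - x| < e -> A y.
Proof.
rewrite /interior; split=> [/nbhs_ballP[e /= e0 H]|[e e0 H]].
  exists e => // y yx; apply: H; rewrite -ball_normE /ball_ /=.
  by rewrite distrC.
by apply/nbhs_ballP; exists e => // y; rewrite -ball_normE /ball_ /= distrC => /H.
Qed.

Lemma closureP_norm (A : set V) x :
  closure A x <-> forall e, 0 < e -> exists2 y, A y & `|y - x| < e.
Proof.
split=> [H e e0|H B /nbhs_ballP[e /= e0 He]].
  have [y [Ay]] := H _ (nbhsx_ballx x e e0).
  by rewrite -ball_normE /ball_ /= distrC => xy; exists y.
have [y Ay yx] := H e e0; exists y; split=> //; apply: He.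
by rewrite -ball_normE /ball_ /= distrC.
Qed.

Lemma compact_norm_bounded (K : set V) : compact K ->
  exists2 c, 0 < c & forall x, K x -> `|x| <= c.
Proof.
move=> /compact_bounded[M [_ HM]]; exists (`|M| + 1); first by rewrite ltr_wpDl.
by move=> x Kx; apply: HM Kx; rewrite ltr_pwDr // ler_norm.
Qed.

Lemma ball_totally_bounded (rho e : R) : 0 < e ->
  exists s : seq V, forall x, `|x| <= rho -> exists2 t, t \in s & `|x - t| < e.
Proof.
move=> e0; have cK : compact [set x : V | `|x| <= rho].
  apply: bounded_closed_compact.
    exists rho; split; first exact: num_real.
    by move=> M rM x /= xr; exact: le_trans xr (ltW rM).
  move=> x /closureP_norm H; apply/ler_addgt0Pr => r /H[y /= yr yx].
  rewrite -(subrK y x) (le_trans (ler_normD _ _))// addrC lerD// ltW//.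
  by rewrite distrC.
rewrite compact_cover in cK.
have [||D _ cD] := cK V setT (fun t => ball t e).
- by move=> t _; apply: ball_open.
- by move=> x _; exists x => //; exact: ballxx.
exists (enum_fset D) => x /cD[t tD xt]; exists t => //.
by move: xt; rewrite -ball_normE /ball_ /= distrC.
Qed.

(** Finitely many balls of radius [e / 2] cover the bounded region, and each of them contains at
    most one point of [F]. *)
Lemma separated_finite (F : set V) (rho e : R) : 0 < e ->
  (forall x, F x -> `|x| <= rho) ->
  (forall x y, F x -> F y -> `|x - y| < e -> x = y) -> finite_set F.
Proof.
move=> e0 Fb Fs.
have [s Hs] := @ball_totally_bounded rho (e / 2) (divr_gt0 e0 (ltr0n _ 2)).
pose g t := xget 0 [set x | F x /\ `|x - t| < e / 2].
apply: (@sub_finite_set _ _ (g @` [set` s])); last first.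
  by apply: finite_image; exact: finite_seq.
move=> x Fx; have [t ts xt] := Hs x (Fb x Fx); exists t => //.
rewrite /g; case: xgetP => [y _ [Fy yt]|/(_ x)[]//].
apply: Fs => //; rewrite -(subrKA t) (splitr e).
by rewrite (le_lt_trans (ler_normD _ _))// ltrD// distrC.
Qed.
Lemma norm_le_sqnorm (x : V) : `|x| ^+ 2 <= sqnorm x.
Proof.
have sq0 (A : pred 'I_d) : 0 <= \sum_(i < d | A i) x ord0 i * x ord0 i.
  by apply: sumr_ge0 => i _; rewrite -expr2 sqr_ge0.
have [E|/mx_norm_neq0[[i j] E]] := eqVneq (mx_norm x) 0.
  by rewrite [ `|x| ]E expr0n; exact: sq0.
rewrite [ `|x| ]E ord1 /= real_normK ?num_real// /sqnorm /dotv (bigD1 j)//=.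
by rewrite expr2 lerDl sq0.
Qed.

Lemma norm_lt_sqnorm (x : V) (r : R) : 0 < r -> sqnorm x < r ^+ 2 -> `|x| < r.
Proof.
move=> r0 xr; rewrite -(@ltr_pXn2r _ 2) ?nnegrE// ?ltW//.
exact: le_lt_trans (norm_le_sqnorm x) xr.
Qed.

(** The hull is defined with Euclidean balls, the library topology with the sup norm. The crude
    factor [d.+1] avoids the square root of [d] and keeps the inequality strict, also for
    [d = 0]. *)
Lemma sqnorm_lt_norm (x : V) (r : R) : 0 < r -> `|x| < r ->
  sqnorm x < (r * d.+1%:R) ^+ 2.
Proof.
move=> r0 xr; apply: (@le_lt_trans _ _ (r ^+ 2 * d%:R)).
  rewrite mulr_natr -[in leRHS](card_ord d) -sumr_const; apply: ler_sum => i _.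
  rewrite -expr2 -[leLHS]real_normK ?num_real//.
  rewrite (@ler_pXn2r _ 2) ?nnegrE ?normr_ge0 ?(ltW r0)//; apply: ltW.
  exact: le_lt_trans (rV_norm_coord x i) xr.
rewrite exprMn ltr_pM2l ?exprn_gt0// -natrX ltr_nat.
by apply: (leq_trans (ltnSn d)); rewrite expnS leq_pmulr// expn_gt0.
Qed.

End RowVectors.

(** * Tiles and local agreement of tilings *)

Ltac vec := by apply/rowP => ?; rewrite !mxE; ring.

Section Tiles.
Variables (R : realType) (d : nat) (Lab : finType).
Local Notation V := 'rV[R]_d.
Local Notation tile := (tile R d Lab).
Implicit Types (U : tile) (S : set tile).

Definition meets U (r : R) := exists2 y, tsupp U y & `|y| < r.

(** Unlike [lm_close], this allows no small shift: for fixed [r] it is an equivalence relation, and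
    shifts are carried separately as explicit vectors. *)
Definition agree (r : R) S S' := forall U, meets U r -> S U <-> S' U.

Lemma mem_tr U x y : tsupp (tr U x) y <-> tsupp U (y - x).
Proof.
split=> [[z Uz <-]|Uy]; first by rewrite addrK.
by exists (y - x) => //; rewrite subrK.
Qed.

Lemma trD U x y : tr (tr U x) y = tr U (x + y).
Proof.
congr Tile; rewrite /= /vtr; apply/seteqP; split=> z.
  by move=> [_ [u Uu <-] <-]; exists u => //; rewrite addrA.
by move=> [u Uu <-]; exists (u + x); [exists u|rewrite addrA].
Qed.

Lemma tr0 U : tr U 0 = U.
Proof.
case: U => K l; congr Tile; rewrite /= /vtr; apply/seteqP; split=> z.
  by move=> [u Ku <-]; rewrite addr0.
by move=> Kz; exists z => //; rewrite addr0.
Qed.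

Lemma trK U x : tr (tr U x) (- x) = U.
Proof. by rewrite trD subrr tr0. Qed.

Lemma trNK U x : tr (tr U (- x)) x = U.
Proof. by rewrite trD addNr tr0. Qed.

Lemma ptrE S x U : ptr S x U <-> S (tr U (- x)).
Proof.
split=> [[U' SU' <-]|SU]; first by rewrite trK.
by exists (tr U (- x)) => //; rewrite trNK.
Qed.

Lemma ptrD S x y : ptr (ptr S x) y = ptr S (x + y).
Proof.
apply/seteqP; split=> U; rewrite !ptrE trD opprD; first by rewrite addrC.
by rewrite addrC.
Qed.

Lemma ptr0 S : ptr S 0 = S.
Proof. by apply/seteqP; split=> U; rewrite ptrE oppr0 tr0. Qed.

Lemma interior_tr U x y :
  interior (tsupp (tr U x)) y <-> interior (tsupp U) (y - x).
Proof.
split=> /interiorP_norm[e e0 H]; apply/interiorP_norm; exists e => // z zy.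
  have /mem_tr : tsupp (tr U x) (z + x) by apply: H; move: zy; rewrite opprB addrA.
  by rewrite addrK.
by apply/mem_tr/H; rewrite opprB addrA subrK.
Qed.

Lemma meets_le U (r r' : R) : r <= r' -> meets U r -> meets U r'.
Proof. by move=> rr' [y Uy yr]; exists y => //; exact: lt_le_trans rr'. Qed.

Lemma meets_tr U x (r : R) : meets U r -> meets (tr U x) (r + `|x|).
Proof.
move=> [y Uy yr]; exists (y + x); first by exists y.
by rewrite (le_lt_trans (ler_normD _ _))// ltrD2r.
Qed.

Lemma agree_le r r' S S' : r <= r' -> agree r' S S' -> agree r S S'.
Proof. by move=> rr' H U /(meets_le rr')/H. Qed.

Lemma agree_sym r S S' : agree r S S' -> agree r S' S.
Proof. by move=> H U /H[]. Qed.

Lemma agree_trans r S S' S'' : agree r S S' -> agree r S' S'' -> agree r S S''.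
Proof.
move=> H1 H2 U rU.
by split=> [/(H1 U rU)/(H2 U rU)|/(H2 U rU)/(H1 U rU)].
Qed.

Lemma agree_tr r S S' x : agree (r + `|x|) S S' -> agree r (ptr S x) (ptr S' x).
Proof.
by move=> H U /(meets_tr (- x)); rewrite normrN => /H; rewrite !ptrE.
Qed.

(** Pointwise form of what is used of a tiling. Covering is only up to closure, as in [psupp]. *)
Record good S : Prop := Good {
  good_closure : forall U, S U -> forall x e, tsupp U x -> 0 < e ->
    exists2 y, interior (tsupp U) y & `|y - x| < e;
  good_disj : forall U U' x, S U -> S U' ->
    interior (tsupp U) x -> interior (tsupp U') x -> U = U';
  good_cover : forall x e, 0 < e ->
    exists U y, [/\ S U, tsupp U y & `|y - x| < e] }.

Lemma is_tiling_good S : is_tiling S -> good S.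
Proof.
move=> [[tS dS] cS]; split.
- move=> U /tS[_ UE] x e; rewrite UE => /closureP_norm H /H[y].
  by rewrite -UE; exists y.
- move=> U U' x SU SU' Ux U'x; apply: contrapT => /(dS _ _ SU SU').
  by move/seteqP => [/(_ x)[]].
- move=> x e e0; have /closureP_norm/(_ e e0) : psupp S x by rewrite cS.
  by move=> [y [U SU Uy] yx]; exists U, y.
Qed.

Lemma good_ptr S x : good S -> good (ptr S x).
Proof.
move=> [H1 H2 H3]; split.
- move=> U /ptrE SU y e Uy e0.
  have [|z zU zy] := H1 _ SU (y - x) e _ e0.
    by apply/mem_tr; rewrite opprK subrK.
  exists (z + x); last by move: zy; rewrite opprB addrA.
  by rewrite -(trNK U x); apply/interior_tr; rewrite addrK.
- move=> U U' y /ptrE SU /ptrE SU' Uy U'y.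
  rewrite -(trNK U x) -(trNK U' x); congr tr.
  by apply: (H2 _ _ (y - x) SU SU'); apply/interior_tr; rewrite opprK subrK.
- move=> y e e0; have [U [z [SU Uz zy]]] := H3 (y - x) e e0.
  exists (tr U x), (z + x); split; first by exists U.
    by exists z.
  by move: zy; rewrite opprB addrA.
Qed.

(** Since [U] is the closure of its interior, interior points of [U] lie arbitrarily near [x], hence
    inside [U']. *)
Lemma good_overlap S U U' x : good S -> S U -> S U' ->
  tsupp U x -> interior (tsupp U') x -> U = U'.
Proof.
move=> gS SU SU' Ux /interiorP_norm[e e0 H].
have [y Uy yx] := good_closure gS SU Ux e0.
apply: (good_disj gS SU SU' Uy); apply/interiorP_norm.
exists (e - `|y - x|); first by rewrite subr_gt0.
move=> z zy; apply: H; rewrite -(subrKA y) (le_lt_trans (ler_normD _ _))//.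
by rewrite addrC -ltrBrDl.
Qed.

(* A tile of [S'] meeting the ball overlaps some tile of [S] which meets the ball. *)
Lemma agree_sub r S S' : good S -> good S' ->
  (forall U, S U -> meets U r -> S' U) -> agree r S S'.
Proof.
move=> gS gS' H U' rU'; split=> [SU'|S'U']; first exact: H.
have [y U'y yr] := rU'.
have ry : 0 < r - `|y| by rewrite subr_gt0.
have [z U'z zy] := good_closure gS' S'U' U'y ry.
have zr : `|z| < r.
  by rewrite -(subrK y z) (le_lt_trans (ler_normD _ _))// -ltrBrDr.
have [e e0 He] := (interiorP_norm _ _).1 U'z.
have e'0 : 0 < Num.min e (r - `|z|) by rewrite lt_min e0 subr_gt0.
have [U [w [SU Uw]]] := good_cover gS z e'0.
rewrite lt_min => /andP[we wz].
have wr : `|w| < r.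
  by rewrite -(subrK z w) (le_lt_trans (ler_normD _ _))// -ltrBrDr.
have S'U : S' U by apply: H => //; exists w.
suff <- : U = U' by [].
apply: (good_overlap gS' S'U S'U' Uw); apply/interiorP_norm.
exists (e - `|w - z|); first by rewrite subr_gt0.
move=> t tw; apply: He; rewrite -(subrKA w) (le_lt_trans (ler_normD _ _))//.
by rewrite -ltrBrDr.
Qed.

Definition thick U (r : R) := exists p, forall y, `|y - p| < r -> tsupp U y.

Lemma thick_tr U x r : thick U r -> thick (tr U x) r.
Proof.
move=> [p Hp]; exists (p + x) => y; rewrite opprD addrA addrAC => yp.
by apply/mem_tr/Hp.
Qed.

(** The difference [z] of the two vectors is a period of [U]; if it were nonzero, the points
    [p + z *+ n] would leave every bounded set. *)
Lemma tr_inj U x y p c : tsupp U p -> (forall z, tsupp U z -> `|z| <= c) ->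
  tr U x = tr U y -> x = y.
Proof.
move=> Up Uc Uxy; pose z := x - y.
have Uz : tr U z = U by rewrite /z -trD Uxy trK.
have step q : tsupp U q -> tsupp U (q + z) by rewrite -{2}Uz; exists q.
have H n : tsupp U (p + z *+ n).
  elim: n => [|n IH]; first by rewrite mulr0n addr0.
  by rewrite mulrSr addrA; exact: step.
have zn n : `|z| *+ n <= c + `|p|.
  rewrite -normrMn -(addrK p (z *+ n)) [_ + p]addrC.
  by rewrite (le_trans (ler_normB _ _))// lerD// Uc.
apply/eqP; rewrite -subr_eq0 -/z -normr_eq0; apply: contraT => z0.
have zgt : 0 < `|z| by rewrite lt_neqAle eq_sym z0 /=.
have := zn (Num.bound ((c + `|p|) / `|z|)).
rewrite leNgt => /negP[]; rewrite -mulr_natr mulrC -ltr_pdivrMr//.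
apply: le_lt_trans (archi_boundP _); first exact: lexx.
have cp : 0 <= c by apply: le_trans (Uc _ Up).
by rewrite divr_ge0// addr_ge0.
Qed.

(** The inner balls of two translates at distance below [r] overlap, so the two tiles coincide, and
    a bounded nonempty tile has no nonzero period. *)
Lemma good_separated S U x y c r : good S -> 0 < r -> thick U r ->
  (forall z, tsupp U z -> `|z| <= c) ->
  S (tr U x) -> S (tr U y) -> `|x - y| < r -> x = y.
Proof.
move=> gS r0 [p Hp] Uc Sx Sy xy.
have pU : tsupp U p by apply: Hp; rewrite subrr normr0.
apply: (tr_inj pU Uc); apply: (good_overlap gS Sx Sy (x := p + x)).
  by apply/mem_tr; rewrite addrK.
apply/interior_tr/interiorP_norm; exists (r - `|x - y|); first by rewrite subr_gt0.
move=> z zp; apply: Hp; rewrite -(subrKA (p + x - y)).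
rewrite (le_lt_trans (ler_normD _ _))// -ltrBrDr.
have -> : p + x - y - p = x - y by vec.
by move: zp; rewrite -addrA.
Qed.

Lemma good_finite S U c r rho : good S -> 0 < r -> thick U r ->
  (forall z, tsupp U z -> `|z| <= c) ->
  finite_set [set x | `|x| <= rho /\ S (tr U x)].
Proof.
move=> gS r0 tU Uc; apply: (separated_finite (rho := rho) r0) => [x []//|].
by move=> x y [_ Sx] [_ Sy]; exact: (good_separated gS r0 tU Uc).
Qed.

End Tiles.

(** * Lattices *)

Section Lattices.
Variables (R : realType) (d : nat).
Local Notation V := 'rV[R]_d.
Implicit Types (L M : set V) (B C : 'M[R]_d).

Lemma ltr_floorD1 (x : R) : x < (Num.floor x)%:~R + 1.
Proof. by have /andP[_] := floor_itv x; rewrite intrD. Qed.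

Definition intv (x : V) := forall i, x ord0 i \is a Num.int.

Lemma intv_map (x : V) : intv x -> exists n : 'rV[int]_d,
  x = map_mx (fun z : int => z%:~R) n.
Proof.
move=> Hx; exists (\row_i Num.floor (x ord0 i)).
by apply/rowP => i; rewrite !mxE floorK.
Qed.

Lemma is_latticeP L : is_lattice L <->
  exists2 B, B \in unitmx & forall v, L v <-> intv (v *m invmx B).
Proof.
split=> [[B [uB LE]]|[B uB LE]]; exists B => //.
  move=> v; rewrite LE; split=> [[n ->] i|].
    by rewrite mulmxK// mxE intr_int.
  move=> /intv_map[n vn]; exists n.
  by rewrite -vn mulmxKV.
split=> //; apply/seteqP; split=> v.
  by move=> /LE/intv_map[n vn]; exists n; rewrite -vn mulmxKV.
by move=> [n ->]; apply/LE => i; rewrite mulmxK// mxE intr_int.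
Qed.

Lemma lattice0 L : is_lattice L -> L 0.
Proof. by move=> /is_latticeP[B uB ->] i; rewrite mul0mx mxE rpred0. Qed.

Lemma latticeD L x y : is_lattice L -> L x -> L y -> L (x + y).
Proof.
move=> /is_latticeP[B uB H] /H Lx /H Ly; apply/H => i.
by rewrite mulmxDl mxE rpredD.
Qed.

Lemma latticeN L x : is_lattice L -> L x -> L (- x).
Proof.
by move=> /is_latticeP[B uB H] /H Lx; apply/H => i; rewrite mulNmx mxE rpredN.
Qed.

Lemma lattice_mulrn L x n : is_lattice L -> L x -> L (x *+ n).
Proof.
move=> lL Lx; elim: n => [|n IH]; first by rewrite mulr0n; exact: lattice0.
by rewrite mulrS; exact: latticeD.
Qed.

Lemma mulmx_bounded B : exists2 c, 0 < c & forall v : V, `|v *m B| <= c * `|v|.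
Proof.
exists (1 + \sum_i \sum_j `|B i j|).
  by rewrite ltr_pwDl// sumr_ge0// => i _; apply: sumr_ge0.
move=> v; apply/rV_norm_le => [|j].
  by rewrite mulr_ge0// addr_ge0// sumr_ge0// => i _; apply: sumr_ge0.
rewrite mxE (le_trans (ler_norm_sum _ _ _))//.
rewrite mulrDl mul1r (@le_trans _ _ ((\sum_i \sum_k `|B i k|) * `|v|))//; last first.
  by rewrite lerDr.
rewrite mulr_suml; apply: ler_sum => i _; rewrite normrM mulrC.
rewrite ler_pM//; last exact: rV_norm_coord.
by rewrite (bigD1 j)//= lerDl sumr_ge0.
Qed.

Lemma lattice_cover L : is_lattice L ->
  exists2 c, 0 < c & forall x, exists2 v, L v & `|x - v| <= c.
Proof.
move=> /is_latticeP[B uB LE]; have [c c0 Hc] := mulmx_bounded B.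
exists c => // x; pose n : V := \row_i (Num.floor ((x *m invmx B) ord0 i))%:~R.
exists (n *m B).
  by apply/LE => i; rewrite mulmxK// mxE intr_int.
rewrite -{1}(mulmxKV uB x) -mulmxBl (le_trans (Hc _))//.
rewrite -[leRHS]mulr1 ler_wpM2l ?(ltW c0)//; apply/(rV_norm_le _ ler01) => i.
rewrite !mxE; set a := \sum_j _; rewrite ger0_norm; last first.
  by rewrite subr_ge0 floor_le.
by rewrite lerBlDl ltW// ltr_floorD1.
Qed.

Lemma lattice_lin L (Q : 'M[R]_d) : Q \in unitmx -> is_lattice L ->
  is_lattice (lin Q @` L).
Proof.
move=> uQ /is_latticeP[B uB LE]; apply/is_latticeP.
have uBQ : B *m Q \in unitmx by rewrite unitmx_mul uB.
exists (B *m Q) => // v.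
have E : v *m invmx (B *m Q) = (v *m invmx Q) *m invmx B.
  rewrite -{1}(mulmxKV uQ v) -{1}(mulmxKV uB (v *m invmx Q)).
  by rewrite -(mulmxA _ B Q) mulmxK.
rewrite E; split=> [[x Lx <-]|/LE Lv].
  by rewrite /lin mulmxK//; exact/LE.
by exists (v *m invmx Q) => //; rewrite /lin mulmxKV.
Qed.

Lemma det_int n (A : 'M[R]_n) : (forall i j, A i j \is a Num.int) ->
  \det A \is a Num.int.
Proof.
move=> H; rewrite /determinant rpred_sum// => s _.
by apply: rpredM; [rewrite rpredX// rpredN rpred1|exact: rpred_prod].
Qed.

(** [A] is the identity with row [i] replaced, so its cofactors along that row are those of the
    identity. *)
Lemma det_row_id n (A : 'M[R]_n) (f : 'rV[R]_n) (i : 'I_n) :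
  A = \matrix_(k, l) (if k == i then f ord0 l else (k == l)%:R) ->
  \det A = f ord0 i.
Proof.
move=> AE; rewrite (expand_det_row _ i).
have H j : cofactor A i j = (i == j)%:R.
  have : cofactor A i j = (\adj (1%:M : 'M[R]_n)) j i.
    rewrite [RHS]mxE /cofactor; congr (_ * \det _).
    by apply/matrixP => k l; rewrite AE !mxE eq_sym (negbTE (neq_lift _ _)).
  by rewrite adj1 mxE eq_sym.
rewrite (bigD1 i)//= big1 ?addr0.
  by rewrite H eqxx mulr1 AE mxE eqxx.
by move=> j ji; rewrite H eq_sym (negbTE ji) mulr0.
Qed.

(* Among the matrices with rows in [M], one whose determinant has minimal nonzero modulus is a basis: a vector of [M] with a fractional coordinate could replace a row and shrink the determinant. *)
Lemma overlattice L M (N : nat) : is_lattice L -> L `<=` M ->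
  (forall x y, M x -> M y -> M (x + y)) -> (forall x, M x -> M (- x)) ->
  (0 < N)%N -> (forall x, M x -> L (x *+ N)) -> is_lattice M.
Proof.
move=> lL LM MD MN N0 MNL; have [B uB LE] := (is_latticeP L).1 lL.
have M0 : M 0 by apply: LM; exact: lattice0.
(* Since [N] times [M] lies in [L], [g C] is an integer matrix when the rows of [C] are in [M]; its
   determinant is a fixed nonzero multiple of that of [C], so a minimal nonzero modulus exists. *)
pose g C := (N%:R *: C) *m invmx B.
have gint C : (forall i, M (row i C)) -> \det (g C) \is a Num.int.
  move=> HC; apply: det_int => i j.
  have /LE/(_ j) : L (row i C *+ N) by apply: MNL; exact: HC.
  by rewrite -scaler_nat -linearZ /= -row_mul mxE.
have gE C : \det (g C) = \det C * (N%:R ^+ d * \det (invmx B)).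
  by rewrite /g det_mulmx detZ mulrA; congr (_ * _); rewrite mulrC.
pose Pr k := `[< exists C, [/\ forall i, M (row i C), \det C != 0
   & `|\det (g C)| = k%:R] >].
have exk : exists k, Pr k.
  exists (Num.trunc `|\det (g B)|); apply/asboolP; exists B.
  have HB i : M (row i B).
    apply: LM; apply/LE => j; rewrite -row_mul mulmxV// mxE mxE.
    by case: eqP.
  split=> //; first by rewrite -unitfE -unitmxE.
  by rewrite truncnK// natr_norm_int// gint.
case: (ex_minnP exk) => k /asboolP[C [HC dC gC]] kmin.
have uC : C \in unitmx by rewrite unitmxE unitfE.
have MZ x z : M x -> M (x *~ z).
  have Mn n y : M y -> M (y *+ n).
    by move=> My; elim: n => // n IH; rewrite mulrS; exact: MD.
  by case: z => n Mx; [exact: Mn|rewrite NegzE mulrNz; apply/MN/Mn].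
have Msum (c : 'I_d -> int) : M (\sum_i (row i C *~ c i)).
  by elim/big_ind: _ => // i _; apply: MZ; exact: HC.
have rowE (x : V) : x *m C = \sum_i x ord0 i *: row i C.
  exact: mulmx_sum_row.
apply/is_latticeP; exists C => // v; split=> [Mv|]; last first.
  move=> /intv_map[n vn]; rewrite -(mulmxKV uC v) vn rowE.
  suff -> : \sum_i map_mx (fun z : int => z%:~R) n ord0 i *: row i C =
            \sum_i (row i C *~ n ord0 i) by exact: Msum.
  by apply: eq_bigr => i _; rewrite mxE scaler_int.
apply: contrapT => /existsNP[i /negP ni].
pose c := v *m invmx C.
pose f : V := \row_l (c ord0 l - (Num.floor (c ord0 l))%:~R).
have Mf : M (f *m C).
  suff -> : f *m C = v - \sum_i (row i C *~ Num.floor (c ord0 i)).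
    by apply: MD => //; exact: MN.
  rewrite -(mulmxKV uC v) -/c !rowE -sumrB; apply: eq_bigr => l _.
  by rewrite mxE scalerBl scaler_int.
pose E := \matrix_(k, l) (if k == i then f ord0 l else (k == l)%:R) : 'M[R]_d.
have dE : \det E = f ord0 i by exact: det_row_id.
have f0 : 0 < f ord0 i.
  rewrite mxE subr_gt0 lt_neqAle floor_le andbT.
  by apply: contra ni => /eqP <-; exact: intr_int.
have f1 : f ord0 i < 1.
  by rewrite mxE ltrBlDl ltr_floorD1.
have HEC l : M (row l (E *m C)).
  rewrite row_mul; have [->|li] := eqVneq l i.
    suff -> : row i E = f by [].
    by apply/rowP => j; rewrite !mxE eqxx.
  suff -> : row l E *m C = row l C by [].
  rewrite -[in RHS](mul1mx C) row_mul; congr (_ *m _).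
  by apply/rowP => j; rewrite !mxE (negbTE li).
have dEC : \det (E *m C) = f ord0 i * \det C by rewrite det_mulmx dE.
have dgEC : `|\det (g (E *m C))| = f ord0 i * k%:R.
  by rewrite gE dEC -mulrA normrM gtr0_norm// -gC gE.
have : Pr (Num.trunc `|\det (g (E *m C))|).
  apply/asboolP; exists (E *m C); split=> //.
    by rewrite dEC mulf_neq0// gt_eqF.
  by rewrite truncnK// natr_norm_int// gint.
move=> /kmin; apply/negP; rewrite -ltnNge -(ltr_nat R).
rewrite truncnK ?natr_norm_int ?gint// dgEC gtr_pMl//.
rewrite -gC normr_gt0 gE mulf_neq0// mulf_neq0//.
  by rewrite expf_neq0// pnatr_eq0 -lt0n.
by rewrite -unitfE -unitmxE unitmx_inv.
Qed.

End Lattices.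

(** * Periodic subpatches *)

Section Periods.
Variables (R : realType) (d : nat) (Lab : finType).
Local Notation V := 'rV[R]_d.
Local Notation tile := (tile R d Lab).

Lemma finite_upper_bound (I : eqType) (F : set I) (f : I -> R) :
  finite_set F -> exists c, forall x, F x -> f x <= c.
Proof.
move=> /finite_seqP[s ->]; exists (\sum_(x <- s) `|f x|) => x /= xs.
rewrite (big_rem x)//= (le_trans (ler_norm _))// lerDl.
exact: sumr_ge0.
Qed.

Definition Per (T : set tile) (L : set V) : set tile :=
  [set U | T U /\ forall v, L v -> T (tr U v)].

(** Only membership of the translates in [T] is required: as [Per T L] is stable under [L], they lie
    again in [Per T L] ([period_Per]). *)
Definition period (T : set tile) (L : set V) : set V :=
  [set x | forall U, Per T L U -> T (tr U x)].

Variables (T : set tile) (T0 : tile) (L : set V) (r0 c0 : R).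
Hypotheses (gT : good T) (lL : is_lattice L) (PT0 : Per T L T0)
  (r0_gt0 : 0 < r0) (thickT0 : thick T0 r0)
  (bndT0 : forall z, tsupp T0 z -> `|z| <= c0)
  (neT : forall U, T U -> exists y, tsupp U y)
  (finT : forall r, finite_set [set U | T U /\ meets U r])
  (repT : forall F : set tile, finite_set F -> F `<=` T ->
    exists rho, forall c, exists x, forall U, F U ->
      T (tr U x) /\ forall y, tsupp (tr U x) y -> `|y - c| < rho).

Local Notation M := (period T L).

Lemma Per_tr U v : Per T L U -> L v -> Per T L (tr U v).
Proof.
move=> [TU H] Lv; split; first exact: H.
by move=> u Lu; rewrite trD; apply: H; exact: latticeD.
Qed.

Lemma period_Per x U : M x -> Per T L U -> Per T L (tr U x).
Proof.
move=> Mx PU; split; first exact: Mx.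
by move=> v Lv; rewrite trD addrC -trD; apply: Mx; exact: Per_tr.
Qed.

Lemma lattice_period : L `<=` M.
Proof. by move=> v Lv U [_]; exact. Qed.

Lemma periodD x y : M x -> M y -> M (x + y).
Proof. by move=> Mx My U PU; rewrite -trD; apply: My; exact: period_Per. Qed.

Lemma period_mulrn x n : M x -> M (x *+ n).
Proof.
move=> Mx; elim: n => [|n IH]; last by rewrite mulrS; exact: periodD.
by rewrite mulr0n; apply: lattice_period; exact: lattice0.
Qed.

(** Pigeonhole: the multiples of [x], reduced modulo [L] into a bounded region, are periods, so each
    carries [T0] to a tile of [T] near the origin. There are finitely many, hence two of the first
    multiples agree modulo [L]. The factorial gives one exponent for all [x]. *)
Lemma period_torsion : exists2 N, (0 < N)%N & forall x, M x -> L (x *+ N).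
Proof.
have [c c_gt0 Hc] := lattice_cover lL.
pose F := [set y | `|y| <= c /\ T (tr T0 y)].
have finF : finite_set F by exact: (good_finite c gT r0_gt0 thickT0 bndT0).
pose N := #|` fset_set F|%fset; exists N`!%N; first exact: fact_gt0.
move=> x Mx.
have /choice[f Hf] : forall k : 'I_N.+1, exists y, F y /\ L (x *+ k - y).
  move=> k; have [v Lv xv] := Hc (x *+ k); exists (x *+ k - v); split.
    split=> //; have : M (x *+ k - v).
      apply: periodD; first exact: period_mulrn.
      by apply: lattice_period; exact: latticeN.
    exact.
  by rewrite opprB addrCA subrr addr0.
have [/injectiveP inj|/injectivePn[i [j ij fij]]] := boolP (injectiveb f).
  suff : (N.+1 <= N)%N by rewrite ltnn.
  rewrite -{1}(size_enum_ord N.+1) -(size_map f).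
  apply: uniq_leq_size; first by rewrite map_inj_uniq ?enum_uniq.
  by move=> _ /mapP[k _ ->]; rewrite in_fset_set// inE; have [] := Hf k.
wlog lt_ij : i j ij fij / (i < j)%N.
  move=> W; case: (ltngtP i j) => [|ji|/val_inj]; first exact: W.
    by apply: (W j i); rewrite // eq_sym.
  by move/eqP; rewrite (negbTE ij).
have Lk : L (x *+ (j - i)).
  rewrite mulrnBr ?(ltnW lt_ij)//.
  rewrite (_ : _ - _ = (x *+ j - f j) + - (x *+ i - f i)); last first.
    by rewrite fij opprB addrA subrK.
  by apply: latticeD => //; [have [] := Hf j|apply: latticeN => //; have [] := Hf i].
have /dvdnP[q ->] : (j - i %| N`!)%N.
  apply: dvdn_fact; rewrite subn_gt0 lt_ij /= (leq_trans (leq_subr _ _))//.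
  by rewrite -ltnS.
by rewrite mulnC mulrnA; exact: lattice_mulrn.
Qed.

(** So far the periods only form a monoid; torsion modulo [L] turns a multiple of [x] into an
    inverse. *)
Lemma periodN x : M x -> M (- x).
Proof.
move=> Mx; have [[//|N] _ HN] := period_torsion.
have -> : - x = x *+ N - x *+ N.+1 by rewrite mulrS opprD addrCA subrr addr0.
apply: periodD; first exact: period_mulrn.
by apply: lattice_period; apply: latticeN => //; exact: HN.
Qed.

Lemma period_lattice : is_lattice M.
Proof.
have [N N0 HN] := period_torsion.
apply: (overlattice lL lattice_period _ _ N0) => //.
  exact: periodD.
exact: periodN.
Qed.

(** Modulo [L], which preserves the periodic tiles, a candidate [x] takes finitely many values [y],
    because [T0 + y] must be a tile of [T] near the origin. Each [y] that is not a period is refuted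
    by a single periodic tile, so one radius reaches all these witnesses. *)
Lemma period_local : exists R1, forall x,
  (forall U, Per T L U -> meets (tr U x) R1 -> T (tr U x)) -> M x.
Proof.
have [c c_gt0 Hc] := lattice_cover lL.
pose F := [set y | `|y| <= c /\ T (tr T0 y)].
have finF : finite_set F by exact: (good_finite c gT r0_gt0 thickT0 bndT0).
have /choice[g Hg] : forall y, exists Ry, ~ M y ->
    exists U, [/\ Per T L U, meets (tr U y) Ry & ~ T (tr U y)].
  move=> y; have [?|/existsNP[U /not_implyP[PU nTU]]] := pselect (M y).
    by exists 0.
  have [z Uz] := neT PU.1; exists (`|z + y| + 1) => _; exists U; split=> //.
  exists (z + y); last by rewrite ltrDl.
  by apply/mem_tr; rewrite addrK.
have [R2 HR2] := finite_upper_bound g finF.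
(* The summand [c0 + c + 1] makes the translate of [T0] by the reduced vector meet the ball, so that
   this vector lies in [F]; [R2] reaches the refuting tiles. *)
exists (`|R2| + (c0 + c + 1)) => x Hx.
have [v Lv xv] := Hc x.
suff Mxv : M (x - v).
  rewrite -(subrK v x); apply: periodD => //; exact: lattice_period.
have Hxv U : Per T L U -> meets (tr U (x - v)) (`|R2| + (c0 + c + 1)) ->
    T (tr U (x - v)).
  move=> PU; rewrite addrC -trD; apply: Hx; apply: Per_tr => //.
  exact: latticeN.
have [p Hp] := thickT0.
have T0p : tsupp T0 p by apply: Hp; rewrite subrr normr0.
have Fxv : F (x - v).
  split=> //; apply: Hxv => //; exists (p + (x - v)).
    by apply/mem_tr; rewrite addrK.
  rewrite (le_lt_trans (ler_normD _ _))//.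
  have := bndT0 T0p; have := normr_ge0 R2; lra.
apply: contrapT => /Hg[U [PU mU nTU]]; apply/nTU/Hxv => //.
apply: meets_le mU; rewrite (le_trans (HR2 _ Fxv))//.
rewrite (le_trans (ler_norm _))// lerDl.
have := bndT0 T0p; have := normr_ge0 p; lra.
Qed.

(** The tiles of [T] near the origin form a finite patch [F] such that [F + s] inside [T] forces
    [- s] to be a period. Repetitivity puts a copy of [F] in the ball where the two translates
    agree; read in both, it gives two such [s], whose difference is [w - w']. *)
Lemma period_recognizable : exists rho, forall w w',
  agree rho (ptr T w) (ptr T w') -> M (w - w').
Proof.
have [R1 HR1] := period_local.
pose F := [set U | T U /\ meets U R1].
have [|rho Hrho] := repT (finT R1); first by move=> U [].
have HM s : (forall U, F U -> T (tr U s)) -> M (- s).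
  move=> HF; apply: HR1 => U PU mU.
  have gTs : good (ptr T (- s)) by exact: good_ptr.
  have H : agree R1 T (ptr T (- s)).
    apply: agree_sub => // U' TU' mU'; apply/ptrE; rewrite opprK.
    exact: HF.
  apply/(H _ mU); apply/ptrE; rewrite trD subrr tr0.
  exact: PU.1.
exists rho => w w' ww'; have [t Ht] := Hrho (- w).
have Mt : M (- t) by apply: HM => U /Ht[].
have Mt' : M (- (t + w - w')).
  apply: HM => U FU; have [TUt HU] := Ht U FU.
  have [y Uy] := neT TUt.
  have /ww' : meets (tr U (t + w)) rho.
    exists (y + w); last by move: (HU _ Uy); rewrite opprK.
    by rewrite -trD; apply/mem_tr; rewrite addrK.
  rewrite !ptrE trD trD addrK => -[H _].
  exact: H.
rewrite (_ : w - w' = - t + - (- (t + w - w'))); last by vec.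
by apply: periodD => //; exact: periodN.
Qed.

End Periods.

(** * Upper Banach density *)

Section Density.
Variables (R : realType) (d : nat).
Local Notation V := 'rV[R]_d.
Implicit Types (phi psi : V -> R).

(* [density_le phi c]: the upper Banach mean of [phi] over translations, that is the infimum over finite families [s] of the supremum over [w] of the average of [phi] on [w + s], is at most [c]. *)
Definition density_le phi (c : R) := forall eps, 0 < eps ->
  exists2 s : seq V, s != [::] &
    forall w, \sum_(x <- s) phi (w + x) <= (c + eps) * (size s)%:R.

Lemma ler_sum_size (I : Type) (s : seq I) (f : I -> R) b :
  (forall x, f x <= b) -> \sum_(x <- s) f x <= b * (size s)%:R.
Proof.
move=> fb; elim: s => [|x s IH]; first by rewrite big_nil mulr0.
by rewrite big_cons /= -natr1 mulrDr mulr1 addrC lerD.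
Qed.

Lemma density_le_mono phi psi c c' : (forall x, phi x <= psi x) -> c <= c' ->
  density_le psi c -> density_le phi c'.
Proof.
move=> Hle cc' H eps /H[s s0 Hs]; exists s => // w.
apply: (@le_trans _ _ (\sum_(x <- s) psi (w + x))); first by apply: ler_sum.
by rewrite (le_trans (Hs w))// ler_wpM2r// lerD2r.
Qed.

(** The family of all sums [x + y] serves both functions: with one index fixed, the sum over the
    other is a translate of an average already bounded. *)
Lemma density_leD phi psi c c' : density_le phi c -> density_le psi c' ->
  density_le (fun x => phi x + psi x) (c + c').
Proof.
move=> H1 H2 eps eps0; have e2 : 0 < eps / 2 by rewrite divr_gt0.
have [s s0 Hs] := H1 _ e2; have [t t0 Ht] := H2 _ e2.
exists [seq x + y | x <- s, y <- t].
  by case: s s0 {Hs} => // x s _; case: t t0 {Ht}.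
move=> w; rewrite big_split /= size_allpairs natrM.
have -> : (c + c' + eps) * ((size s)%:R * (size t)%:R) =
    (c + eps / 2) * (size s)%:R * (size t)%:R +
    (c' + eps / 2) * (size t)%:R * (size s)%:R by field.
apply: lerD.
  rewrite big_allpairs_dep exchange_big /=.
  apply: ler_sum_size => y.
  rewrite (eq_bigr (fun x => phi ((w + y) + x))) ?Hs// => x _.
  by rewrite -addrA [y + x]addrC.
rewrite big_allpairs_dep; apply: ler_sum_size => x /=.
rewrite (eq_bigr (fun y => psi ((w + x) + y))) ?Ht// => y _.
by rewrite addrA.
Qed.

Lemma density_leM phi c r : 0 < r -> density_le phi c ->
  density_le (fun x => r * phi x) (r * c).
Proof.
move=> r0 H eps eps0; have [s s0 Hs] := H _ (divr_gt0 eps0 r0).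
exists s => // w; rewrite -mulr_sumr.
have -> : (r * c + eps) * (size s)%:R = r * ((c + eps / r) * (size s)%:R).
  by field; rewrite gt_eqF.
by rewrite ler_wpM2l// ltW.
Qed.

Lemma density_le_cst (c : R) : density_le (fun=> c) c.
Proof.
move=> eps eps0; exists [:: 0] => // w.
by rewrite big_seq1 /= mulr1 lerDl ltW.
Qed.

Lemma density_le_translate phi c t : density_le phi c ->
  density_le (fun x => phi (x + t)) c.
Proof.
move=> H eps /H[s s0 Hs]; exists s => // w.
rewrite (eq_bigr (fun x => phi ((w + t) + x))) => // x _.
by rewrite addrAC.
Qed.

Lemma density_le_linear phi c (f g : V -> V) :
  {morph f : x y / x + y} -> cancel f g -> cancel g f ->
  density_le phi c -> density_le (phi \o f) c.
Proof.
move=> fD fK gK H eps /H[s s0 Hs]; exists (map g s).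
  by case: s s0 {Hs}.
move=> w; rewrite big_map size_map.
rewrite (eq_bigr (fun x => phi (f w + x))) => // x _.
by rewrite /= fD gK.
Qed.

(* Averaging over [0, t, ..., (n-1) t] telescopes. *)
Lemma density_le_coboundary phi t (b : R) : (forall x, `|phi x| <= b) ->
  density_le (fun x => phi (x + t) - phi x) 0.
Proof.
move=> Hb eps eps0.
have b0 : 0 <= b by apply: le_trans (Hb 0).
pose n := (Num.bound (2 * b / eps)).+1.
exists [seq t *+ k | k <- iota 0 n] => // w.
rewrite big_map size_map size_iota add0r.
rewrite -{1}(subn0 n) -/(index_iota 0 n).
rewrite (eq_bigr (fun k => phi (w + t *+ k.+1) - phi (w + t *+ k))); last first.
  by move=> k _; rewrite mulrSr addrA.
rewrite telescope_sumr//.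
apply: (@le_trans _ _ (2 * b)).
  have := Hb (w + t *+ n); have := Hb (w + t *+ 0).
  rewrite !ler_norml => /andP[h1 h2] /andP[h3 h4]; lra.
rewrite -ler_pdivrMl// mulrC; apply/ltW.
have /archi_boundP h : 0 <= 2 * b / eps by rewrite divr_ge0 ?mulr_ge0// ltW.
apply: (lt_trans h); by rewrite ltr_nat.
Qed.

Lemma density_le_sum (I : Type) (s : seq I) (f : I -> V -> R) :
  (forall i, density_le (f i) 0) ->
  density_le (fun x => \sum_(i <- s) f i x) 0.
Proof.
move=> H; elim: s => [|i s IH].
  apply: (density_le_mono (psi := fun=> 0) _ (lexx 0)); last exact: density_le_cst.
  by move=> x; rewrite big_nil.
have := density_leD (H i) IH; rewrite addr0; apply: density_le_mono => // x.
by rewrite big_cons.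
Qed.

End Density.

(** * Expansion maps *)

Section Expansion.
Variable R : realType.
Local Notation nrm := (@Normc.normc R).

Lemma nrm_real (x : R) : nrm (Complex x 0) = `|x|.
Proof. by rewrite /Normc.normc expr0n addr0 sqrtr_sqr. Qed.

Lemma nrm_ge0 z : 0 <= nrm z.
Proof. by case: z => a b; exact: sqrtr_ge0. Qed.

Lemma nrm_gt1 (z : R[i]) : (1 < `|z|) = (1 < nrm z).
Proof. by rewrite normc_def; case: z => a b /=; rewrite ltcR. Qed.

Definition vanishing (a : nat -> R) :=
  forall eps, 0 < eps -> exists N, forall n, (N <= n)%N -> a n < eps.

Lemma vanishing_expr (q : R) : 0 <= q -> q < 1 -> vanishing (fun n => q ^+ n).
Proof.
move=> q0 q1 eps eps0.
have /cvgrPdist_lt/(_ eps eps0)[N _ HN] : (fun n => q ^+ n) @ \oo --> (0 : R).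
  by apply: cvg_expr; rewrite ger0_norm.
exists N => n /HN; rewrite sub0r normrN ger0_norm//.
exact: exprn_ge0.
Qed.

Lemma vanishing_contraction (q : R) (a c : nat -> R) : 0 <= q -> q < 1 ->
  (forall n, 0 <= a n) -> vanishing c ->
  (forall n, a n.+1 <= q * (a n + c n)) -> vanishing a.
Proof.
move=> q0 q1 a0 Hc Ha eps eps0.
have p0 : 0 < 1 - q by rewrite subr_gt0.
(* Once [c n] is below this value the bound [eps / 2] reproduces itself, because
   [q (1 + (1 - q)) = 1 - (1 - q)^2 <= 1]. *)
have e2 : 0 < eps * (1 - q) / 2 by rewrite divr_gt0// mulr_gt0.
have [N HN] := Hc _ e2.
have H k : a (N + k)%N <= q ^+ k * a N + eps / 2.
  elim: k => [|k IH]; first by rewrite addn0 expr0 mul1r lerDl divr_ge0// ltW.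
  rewrite addnS (le_trans (Ha _))//.
  have h1 := ltW (HN (N + k)%N (leq_addr _ _)).
  have h2 : q * (a (N + k)%N + c (N + k)%N) <=
            q * (q ^+ k * a N + eps / 2 + eps * (1 - q) / 2).
    by rewrite ler_wpM2l// lerD.
  rewrite (le_trans h2)// exprS.
  have : 0 <= eps / 2 * (1 - q) ^+ 2 by rewrite mulr_ge0 ?sqr_ge0 ?divr_ge0 ?ltW.
  nra.
have a1 : 0 < eps / 2 / (a N + 1) by rewrite !divr_gt0// ltr_wpDl.
have [K HK] := vanishing_expr q0 q1 a1.
exists (N + K)%N => n Kn.
rewrite -(subnKC (leq_trans (leq_addr K N) Kn)) (le_lt_trans (H _))//.
have /HK : (K <= n - N)%N by rewrite leq_subRL// (leq_trans (leq_addr K N) Kn).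
rewrite ltr_pdivlMr ?ltr_wpDl// => h.
have : q ^+ (n - N) * a N <= q ^+ (n - N) * (a N + 1).
  by rewrite ler_wpM2l ?exprn_ge0// lerDl.
lra.
Qed.

Section Powers.
Variable d : nat.
Variables (Q A : 'M[R[i]]_d.+1).
Hypothesis QA : Q * A = 1.

(** Induction on the eigenvalues, in place of a Jordan form:
    [B (Q - z) A^(n+1) = B A^n - z B A^(n+1)]. The left side vanishes by induction, so the entries
    of [B A^n] satisfy a contraction with ratio [1 / |z|]. Cayley-Hamilton supplies the annihilating
    product for [B = 1]. *)
Lemma vanishing_powers (zs : seq R[i]) (B : 'M[R[i]]_d.+1) :
  all (fun z => 1 < nrm z) zs ->
  B * horner_mx Q (\prod_(z <- zs) ('X - z%:P)) = 0 ->
  forall i j, vanishing (fun n => nrm ((B * A ^+ n) i j)).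
Proof.
elim: zs B => [|z zs IH] B /=.
  move=> _; rewrite big_nil rmorph1 mulr1 => -> i j eps eps0.
  by exists 0%N => n _; rewrite mul0r mxE Normc.normc0.
move=> /andP[z1 zs1]; rewrite big_cons rmorphM /= mulrA => H i j.
have := IH _ zs1 H i j.
rewrite rmorphB /= horner_mx_X horner_mx_C => Hc.
have z0 : 0 < nrm z by apply: lt_trans z1.
apply: (@vanishing_contraction (nrm z)^-1 _
  (fun n => nrm ((B * (Q - z%:M) * A ^+ n.+1) i j))).
- by rewrite invr_ge0 ltW.
- by rewrite invf_lt1.
- by move=> n; exact: nrm_ge0.
- by move=> eps /Hc[N HN]; exists N => n Nn; apply: HN; exact: leqW.
move=> n.
have E : B * (Q - z%:M) * A ^+ n.+1 = B * A ^+ n - z *: (B * A ^+ n.+1).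
  rewrite mulrBr mulrBl exprS -mulrA (mulrA Q) QA mul1r; congr (_ - _).
  by rewrite -[z%:M]mulmx1 -mulmxE mul_scalar_mx -scalemxAr mulmx1 scalemxAl.
have Ez : nrm z * nrm ((B * A ^+ n.+1) i j) =
    nrm ((B * A ^+ n) i j - (B * (Q - z%:M) * A ^+ n.+1) i j).
  by rewrite E !mxE opprB addrCA subrr addr0 Normc.normcM.
rewrite mulrC ler_pdivlMr// mulrC Ez.
by rewrite (le_trans (le_normcD _ _))// normcN.
Qed.
End Powers.

Variables (d : nat) (Q : 'M[R]_d).
Hypothesis expQ : expansion_map Q.

Lemma expansion_unitmx : Q \in unitmx.
Proof.
rewrite unitmxE unitfE; apply/negP => /eqP dQ.
suff /expQ : root (map_poly (fun r => Complex r 0) (char_poly Q)) 0.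
  by rewrite normr0 ltr10.
rewrite /root.
have -> : (0 : R[i]) = (0 : R)%:C%C by [].
rewrite (horner_map (real_complex R)) horner_coef0 char_poly_det dQ mulr0.
by rewrite rmorph0.
Qed.

Lemma expansion_contracts (rho r : R) : 0 < r -> exists n, forall x : 'rV[R]_d,
  `|x| <= rho -> `|iter n (lin (invmx Q)) x| < r.
Proof.
move=> r0; have uQ := expansion_unitmx.
(* The ring structure on square matrices needs positive size; in dimension 0 every vector is 0. *)
case: d Q expQ uQ => [|d'] Q' expQ' uQ'.
  exists 0%N => x _ /=; suff -> : x = 0 by rewrite normr0.
  by apply/rowP => -[].
pose toC := real_complex R; pose Qc := map_mx toC Q'.
pose Ac := map_mx toC (invmx Q').
have QA : Qc * Ac = 1 by rewrite /Qc /Ac -mulmxE -map_mxM mulmxV// map_mx1.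
have [zs Hzs] := closed_field_poly_normal (char_poly Qc).
move: Hzs; rewrite (monicP (char_poly_monic _)) scale1r => Hzs.
have zs1 : all (fun z => 1 < nrm z) zs.
  apply/allP => z zzs; rewrite -nrm_gt1; apply: expQ'.
  have -> : map_poly (fun r : R => Complex r 0) (char_poly Q') = char_poly Qc.
    exact: (map_char_poly (real_complex R) Q').
  by rewrite Hzs root_prod_XsubC.
have := @vanishing_powers d' Qc Ac QA zs 1 zs1.
rewrite -Hzs Cayley_Hamilton mulr0 => /(_ erefl) Hv.
pose e := r / ((`|rho| + 1) * d'.+1%:R).
have e0 : 0 < e by rewrite divr_gt0// mulr_gt0// ltr_wpDl.
have /choice[N HN] : forall ij : 'I_d'.+1 * 'I_d'.+1, exists N,
    forall n, (N <= n)%N -> nrm ((1 * Ac ^+ n) ij.1 ij.2) < e.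
  by move=> [i j]; exact: Hv.
pose n := \max_ij N ij.
exists n => x xrho.
have -> : iter n (lin (invmx Q')) x = x *m (invmx Q') ^+ n.
  elim: n => [|n IH]; first by rewrite expr0 mulmx1.
  by rewrite iterS IH /lin -mulmxA mulmxE -exprSr.
have Hn i j : `|(invmx Q' ^+ n) i j| < e.
  have := HN (i, j) n (leq_bigmax _); rewrite mul1r /=.
  by rewrite /Ac -(rmorphXn (map_mx toC)) /= mxE nrm_real.
apply: (@le_lt_trans _ _ (`|rho| * e * d'.+1%:R)); last first.
  have p1 : 0 < `|rho| + 1 by rewrite ltr_wpDl.
  have -> : `|rho| * e * d'.+1%:R = r * (`|rho| / (`|rho| + 1)).
    by rewrite /e; field; rewrite !gt_eqF//= -natr1 ltr_wpDl.
  by rewrite gtr_pMr// ltr_pdivrMr// mul1r ltrDl.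
apply/rV_norm_le => [|j]; first by rewrite !mulr_ge0// ltW.
rewrite mxE (le_trans (ler_norm_sum _ _ _))//.
rewrite mulr_natr -[in leRHS](card_ord d'.+1) -sumr_const.
apply: ler_sum => i _; rewrite normrM ler_pM//; last exact/ltW.
rewrite (le_trans (rV_norm_coord _ _))// (le_trans xrho)//.
exact: ler_norm.
Qed.
End Expansion.

(** * Supertiles and the density of the uncovered part *)

Section SelfAffine.
Variables (R : realType) (d : nat) (Lab : finType) (m : nat).
Local Notation V := 'rV[R]_d.
Local Notation tile := (tile R d Lab).
Variables (P : 'I_m -> tile) (Q : 'M[R]_d) (omega : 'I_m -> set tile).
Variables (T : set tile) (T0 : tile) (L : set V).
Hypotheses (substP : subst_rule P Q omega) (primP : primitive P omega)
  (saT : self_affine_tiling P Q omega T) (TT0 : T T0) (lL : is_lattice L)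
  (TL : forall v, L v -> T (tr T0 v)) (QL : lin Q @` L `<=` L).

Lemma iter_linD n (A : 'M[R]_d) x y :
  iter n (lin A) (x + y) = iter n (lin A) x + iter n (lin A) y.
Proof. by elim: n => //= n ->; rewrite /lin mulmxDl. Qed.

Lemma iter_linB n (A : 'M[R]_d) x y :
  iter n (lin A) (x - y) = iter n (lin A) x - iter n (lin A) y.
Proof. by elim: n => //= n ->; rewrite /lin mulmxBl. Qed.

Lemma iter_linK n (A : 'M[R]_d) : A \in unitmx ->
  cancel (iter n (lin A)) (iter n (lin (invmx A))).
Proof.
by move=> uA; elim: n => // n IH x; rewrite iterSr iterS [lin _ (lin _ _)]mulmxK.
Qed.

Lemma iter_linVK n (A : 'M[R]_d) : A \in unitmx ->
  cancel (iter n (lin (invmx A))) (iter n (lin A)).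
Proof.
by move=> uA x; rewrite -{1}(invmxK A) iter_linK// unitmx_inv.
Qed.

Lemma iter_lin_bounded n (A : 'M[R]_d) :
  exists2 c, 0 < c & forall x, `|iter n (lin A) x| <= c * `|x|.
Proof.
have [a a0 Ha] := mulmx_bounded A; exists (a ^+ n); first exact: exprn_gt0.
elim: n => [|n IH] x; first by rewrite expr0 mul1r.
by rewrite iterS exprS -mulrA (le_trans (Ha _))// ler_wpM2l// ltW.
Qed.

Lemma uQ : Q \in unitmx.
Proof. by apply: expansion_unitmx; have [_ [_ []]] := substP. Qed.

Lemma good_T : good T.
Proof. by apply: is_tiling_good; case: saT. Qed.

Lemma T_translate U : T U -> exists i x, U = tr (P i) x.
Proof. by move=> TU; case: saT => _ H _ _ _; exact: H. Qed.

(* An empty prototile would only produce empty tiles, and primitivity would make every prototile empty. *)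
Lemma prototile_nonempty i : exists y, tsupp (P i) y.
Proof.
apply: contrapT => Hi.
have H k j l : mxpow (subst_matrix P omega) k j l != 0 ->
    ~ (exists y, tsupp (P l) y) -> ~ exists y, tsupp (P j) y.
  elim: k l => [|k IH] l.
    by rewrite /mxpow /= mxE; case: (eqVneq j l) => [-> _|_]; rewrite ?eqxx.
  rewrite /mxpow iterS -/(mxpow _ k) mxE => Hjl nl.
  have [n Hn] : exists n, mxpow (subst_matrix P omega) k j n *
      subst_matrix P omega n l != 0.
    apply: contrapT => /forallNP Hn; move/negP: Hjl; apply; apply/eqP.
    by apply: big1 => n _; apply/eqP; have /negP := Hn n; rewrite negbK.
  move: Hn; rewrite mulf_eq0 => /norP[/IH{}IH Hnl]; apply: IH => -[y Pny].
  have [x Ox] : exists x, omega l (tr (P n) x).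
    apply: contrapT => /forallNP Hx; move: Hnl; rewrite mxE.
    suff -> : [set x | omega l (tr (P n) x)] = set0 by rewrite fset_set0 eqxx.
    by apply/seteqP; split=> x // /Hx.
  have [_ [_ [_ /(_ l)[_ _ _ supl]]]] := substP.
  have : psupp (omega l) (y + x).
    apply: subset_closure; exists (tr (P n) x) => //.
    by apply/mem_tr; rewrite addrK.
  by rewrite supl => -[z Plz _]; apply: nl; exists z.
have [U [y [TU Uy _]]] := good_cover good_T 0 ltr01.
have [j [x Ux]] := T_translate TU.
have [k [_ /(_ j i)]] := primP.
move=> /lt0r_neq0/H/(_ Hi); apply; exists (y - x).
by move: Uy; rewrite Ux => /mem_tr.
Qed.

Lemma prototile_thick : exists2 r0, 0 < r0 & forall i, thick (P i) r0.
Proof.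
have /choice[r Hr] : forall i, exists r, 0 < r /\ thick (P i) r.
  move=> i; have [y Py] := prototile_nonempty i.
  have [_ [/(_ i)[_ Pi] _]] := substP.
  move: Py; rewrite Pi => /closureP_norm/(_ _ ltr01)[x /interiorP_norm[e e0 He] _].
  by exists e; split=> //; exists x.
have [e e0 He] : exists2 e, 0 < e & forall i, i \in enum 'I_m -> e <= r i.
  elim: (enum 'I_m) => [|i s [e e0 He]]; first by exists 1.
  exists (Num.min e (r i)); first by rewrite lt_min e0; case: (Hr i).
  move=> j; rewrite inE => /orP[/eqP ->|/He ej].
    by rewrite ge_min lexx orbT.
  by rewrite ge_min ej.
exists e => // i; have [_ [p Hp]] := Hr i; exists p => y yp; apply: Hp.
by rewrite (lt_le_trans yp)// He// mem_enum.
Qed.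

Lemma prototile_bounded : exists2 c, 0 < c &
  forall i y, tsupp (P i) y -> `|y| <= c.
Proof.
have /choice[c Hc] : forall i, exists c, 0 < c /\
    forall y, tsupp (P i) y -> `|y| <= c.
  move=> i; have [_ [/(_ i)[/compact_norm_bounded[c c0 Hc] _] _]] := substP.
  by exists c.
exists (1 + \sum_i c i).
  by rewrite ltr_pwDl// sumr_ge0// => i _; case: (Hc i) => /ltW.
move=> i y Py; rewrite (le_trans ((Hc i).2 _ Py))// (bigD1 i)//=.
rewrite addrCA lerDl addr_ge0// sumr_ge0// => j _.
by case: (Hc j) => /ltW.
Qed.

Lemma T_nonempty U : T U -> exists y, tsupp U y.
Proof.
move=> /T_translate[i [x ->]]; have [y Py] := prototile_nonempty i.
by exists (y + x); apply/mem_tr; rewrite addrK.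
Qed.

Lemma T_finite r : finite_set [set U | T U /\ meets U r].
Proof.
have [r0 r00 thP] := prototile_thick; have [c c0 bP] := prototile_bounded.
pose F i := [set x | `|x| <= c + r /\ T (tr (P i) x)].
apply: (@sub_finite_set _ _ (\bigcup_(i in [set: 'I_m]) (tr (P i) @` F i))).
  move=> U [TU [y Uy yr]]; have [i [x Ux]] := T_translate TU.
  exists i => //; exists x => //; split; last by rewrite -Ux.
  move: Uy; rewrite Ux => /mem_tr/bP yx.
  rewrite -(subrK y x) (le_trans (ler_normD _ _))// lerD//; last exact: ltW.
  by rewrite distrC.
apply: bigcup_finite; first exact: finite_finset.
move=> i _; apply: finite_image.
exact: (good_finite _ good_T r00 (thP i) (bP i)).
Qed.

Lemma T_repetitive (F : set tile) : finite_set F -> F `<=` T ->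
  exists rho, forall c, exists x, forall U, F U ->
    T (tr U x) /\ forall y, tsupp (tr U x) y -> `|y - c| < rho.
Proof.
move=> finF FT; have [_ _ _ _ rep] := saT.
have [|rho [rho0 Hrho]] := rep F finF.
  by exists 0; rewrite ptr0.
exists rho => c; have [x [xT xrho]] := Hrho c; exists x => U FU; split.
  by apply: xT; exists U.
move=> y Uy; apply: norm_lt_sqnorm => //; apply: xrho.
by apply: subset_closure; exists (tr U x) => //; exists U.
Qed.

Definition latt n : set V := iter n (fun K => lin Q @` K) L.

Lemma latt_lattice n : is_lattice (latt n).
Proof. by elim: n => //= n IH; apply: lattice_lin => //; exact: uQ. Qed.

Lemma lattS n : latt n.+1 `<=` latt n.
Proof.
elim: n => [|n IH] //; rewrite [X in X `<=` _]/latt iterS -/(latt n.+1).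
by move=> _ [x /IH Lx <-]; exists x.
Qed.

Local Notation Pn n := (Per T (latt n)).

Lemma PerS n U : Pn n U -> Pn n.+1 U.
Proof. by move=> [TU H]; split=> // v /lattS; exact: H. Qed.

Lemma Per_le n k U : (n <= k)%N -> Pn n U -> Pn k U.
Proof.
by move/subnK <-; elim: (k - n)%N => // j IH /IH; rewrite addSn; exact: PerS.
Qed.

Lemma Per_T0 n v : L v -> Pn n (tr T0 v).
Proof.
move=> Lv; apply: (@Per_le 0) => //; split; first exact: TL.
by move=> u Lu; rewrite trD; apply: TL; exact: latticeD.
Qed.

Lemma subst_tile_tr U U' x : subst_tile P Q omega U U' ->
  subst_tile P Q omega (tr U x) (tr U' (lin Q x)).
Proof.
move=> [i [y [-> /ptrE Hy]]]; exists i, (y + x); split; first by rewrite trD.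
apply/ptrE; rewrite trD /lin mulmxDl opprD.
by rewrite addrCA subrr addr0.
Qed.

Lemma T_subst U U' : T U -> subst_tile P Q omega U U' -> T U'.
Proof.
by move=> TU UU'; have [_ _ <- _ _] := saT; exists U.
Qed.

Lemma Per_subst n U U' : Pn n U -> subst_tile P Q omega U U' -> Pn n.+1 U'.
Proof.
move=> [TU HU] UU'; split; first exact: T_subst UU'.
move=> _ [v Lv <-]; apply: (T_subst (HU _ Lv)); exact: subst_tile_tr.
Qed.

Lemma subst_tile_supp U U' y : subst_tile P Q omega U U' -> tsupp U' y ->
  exists2 z, tsupp U z & y = lin Q z.
Proof.
move=> [i [x [-> /ptrE Hx]]] U'y.
have [_ [_ [_ /(_ i)[_ _ _ supi]]]] := substP.
have : psupp (omega i) (y - lin Q x).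
  apply: subset_closure; exists (tr U' (- lin Q x)) => //.
  by apply/mem_tr; rewrite opprK subrK.
rewrite supi => -[z Pz zE]; exists (z + x).
  by apply/mem_tr; rewrite addrK.
by rewrite /lin mulmxDl -/(lin Q z) zE subrK.
Qed.

(** Used contrapositively: a tile outside [P_(n+K)] lies in a level-[K] supertile of a tile outside
    [P_n]. *)
Lemma T_ancestor K U : T U -> exists U', [/\ T U',
  forall n, Pn n U' -> Pn (n + K) U &
  forall y, tsupp U y -> exists2 z, tsupp U' z & y = iter K (lin Q) z].
Proof.
elim: K U => [|K IH] U TU.
  exists U; split=> // [n|y Uy]; first by rewrite addn0.
  by exists y.
have : subst P Q omega T U by have [_ _ -> _ _] := saT.
move=> [U1 TU1 U1U]; have [U' [TU' HP Hs]] := IH U1 TU1.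
exists U'; split=> // [n /HP H|y Uy].
  by rewrite addnS; exact: Per_subst U1U.
have [z U1z ->] := subst_tile_supp U1U Uy.
by have [t U't ->] := Hs z U1z; exists t.
Qed.

Lemma T_diameter : exists2 c, 0 < c & forall U y z, T U ->
  tsupp U y -> tsupp U z -> `|y - z| <= c.
Proof.
have [c c0 Hc] := prototile_bounded; exists (c + c); first exact: addr_gt0.
move=> U y z /T_translate[i [x ->]] /mem_tr/Hc yx /mem_tr/Hc zx.
rewrite (_ : y - z = (y - x) - (z - x)); last by vec.
by rewrite (le_trans (ler_normB _ _))// lerD.
Qed.

Lemma T_thick : exists2 r, 0 < r & forall U, T U -> thick U r.
Proof.
have [r r0 Hr] := prototile_thick; exists r => // U /T_translate[i [x ->]].
exact: thick_tr.
Qed.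

Lemma supertile_contains : exists K, forall U, T U -> exists2 v, L v &
  forall y, tsupp (tr T0 v) y -> interior (tsupp U) (iter K (lin (invmx Q)) y).
Proof.
have [r r0 thT] := T_thick.
have [c c0 bP] := prototile_bounded; have [b b0 Hb] := lattice_cover lL.
have [i0 [x0 T0E]] := T_translate TT0.
have [_ [_ [expQ _]]] := substP.
(* Some [T0 + v] lies within [c + |x0| + b] of [Q^K p], with [b] the covering radius of [L]. [K] is
   chosen so that [Q^-K] shrinks this distance below the inner radius [r] of the tiles. *)
have [K HK] := expansion_contracts expQ (c + `|x0| + b) r0.
exists K => U /thT[p Hp]; have [v Lv pv] := Hb (iter K (lin Q) p).
exists v => // y /mem_tr; rewrite {1}T0E => /mem_tr/bP yv.
apply/interiorP_norm.
have ypr : `|iter K (lin (invmx Q)) y - p| < r.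
  rewrite -[X in _ - X](iter_linK K uQ) -iter_linB; apply: HK.
  rewrite (_ : y - _ = (y - v - x0) + x0 - (iter K (lin Q) p - v)); last by vec.
  rewrite (le_trans (ler_normB _ _))// lerD//.
  by rewrite (le_trans (ler_normD _ _))// lerD2r.
exists (r - `|iter K (lin (invmx Q)) y - p|); first by rewrite subr_gt0.
move=> z zy; apply: Hp; rewrite -(subrKA (iter K (lin (invmx Q)) y)).
by rewrite (le_lt_trans (ler_normD _ _))// -ltrBrDr.
Qed.

Definition uncovered n : set V := [set y | exists U, [/\ T U, ~ Pn n U & tsupp U y]].

(** [A] is the union of the level-[K] supertiles of uncovered tiles, and [Z] consists of balls
    inside the tiles [T0 + v] they contain. The new uncovered set lies in [A] minus [Z], while [k]
    translates of [Z] cover [A], with [k] the number of balls of radius [r] needed for a supertile.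
    This number depends on [K] alone, so the ratio is the same for all [j]. *)
Lemma density_contraction : exists K k : nat, forall j c,
  density_le (\1_(uncovered (j * K)) : V -> R) c ->
  density_le (\1_(uncovered (j.+1 * K)) : V -> R) ((1 - k.+1%:R^-1) * c).
Proof.
have [K HK] := supertile_contains; exists K.
have [r r0 thT] := T_thick; have [D D0 diamT] := T_diameter.
have [a a0 Ha] := iter_lin_bounded K Q.
have [Th HTh] := ball_totally_bounded d (a * D) r0.
exists (size Th) => j c Hc.
have [p0 Hp0] := thT _ TT0.
pose A : set V := uncovered (j * K) \o iter K (lin (invmx Q)).
pose Z := [set y | exists U v, [/\ T U /\ ~ Pn (j * K) U, L v,
  (forall y, tsupp (tr T0 v) y -> interior (tsupp U) (iter K (lin (invmx Q)) y)) &
  `|y - (p0 + v)| < r]].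
have T0v v y : `|y - (p0 + v)| < r -> tsupp (tr T0 v) y.
  by move=> yp; apply/mem_tr/Hp0; rewrite (_ : _ - _ = y - (p0 + v))//; vec.
have intsub (B : set V) y : interior B y -> B y by exact: interior_subset.
have ZA : Z `<=` A.
  move=> y [U [v [[TU nPU] Lv HU yp]]]; exists U; split=> //.
  by apply: intsub; apply: HU; exact: T0v yp.
have ucA : uncovered (j.+1 * K) `<=` A.
  move=> y [U [TU nPU Uy]]; have [U' [TU' HP Hs]] := T_ancestor K TU.
  have [z U'z ->] := Hs _ Uy; exists U'; split=> //; last first.
    by rewrite iter_linK// uQ.
  by move=> /HP; rewrite addnC -mulSn.
have ucZ y : uncovered (j.+1 * K) y -> ~ Z y.
  move=> [U [TU nPU Uy]] [U' [v [_ Lv _ yp]]]; apply: nPU.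
  suff -> : U = tr T0 v by exact: Per_T0.
  apply: (good_overlap good_T TU (TL Lv) Uy); apply/interiorP_norm.
  exists (r - `|y - (p0 + v)|); first by rewrite subr_gt0.
  move=> z zy; apply: T0v; rewrite -(subrKA y).
  by rewrite (le_lt_trans (ler_normD _ _))// -ltrBrDr.
have AZ y : A y -> exists2 t, t \in Th & Z (y - t).
  move=> [U [TU nPU Uy]]; have [v Lv HU] := HK U TU.
  pose q := p0 + v.
  have Uq : tsupp U (iter K (lin (invmx Q)) q).
    by apply: intsub; apply: HU; apply: T0v; rewrite subrr normr0.
  have [|t tTh yqt] := HTh (y - q).
    rewrite -(iter_linVK K uQ (y - q)) (le_trans (Ha _))// ler_wpM2l ?(ltW a0)//.
    by rewrite iter_linB; exact: diamT TU Uy Uq.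
  exists t => //; exists U, v; split=> //.
  by rewrite (_ : y - t - _ = y - q - t)//; rewrite /q; vec.
have dA : density_le (\1_A : V -> R) c.
  have := @density_le_linear R d _ c (iter K (lin (invmx Q))) (iter K (lin Q))
    (@iter_linD K (invmx Q)) (iter_linVK K uQ) (iter_linK K uQ) Hc.
  exact: density_le_mono.
set k := size Th; have k1 : 0 < (k.+1%:R : R) by rewrite ltr0n.
have dZ : density_le (fun x => \sum_(t <- Th) (\1_Z (x - t) - \1_Z x) : R) 0.
  apply: density_le_sum => t; apply: (@density_le_coboundary R d (\1_Z) (- t) 1) => x.
  by rewrite indicE; case: (_ \in _); rewrite ?normr1 ?normr0.
(* For [k = 0] the factor is 0, which [density_leM] excludes; but then no translates cover [A], so
   [A] is empty. *)
have [k0|kpos] := posnP k.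
  have A0 x : ~ A x by move=> /AZ[t]; rewrite (size0nil k0).
  rewrite k0 invr1 subrr mul0r.
  apply: (density_le_mono (psi := fun=> 0) _ (lexx 0)); last exact: density_le_cst.
  by move=> x; rewrite indicE; case: (boolP (_ \in _)) => // /set_mem/ucA/A0.
have kk : 0 < 1 - k.+1%:R^-1 :> R.
  by rewrite subr_gt0 invf_lt1// ltr1n.
(* The pointwise bound is [1 - 1/(k+1)] on [A] plus [1/(k+1)] times the sum of coboundaries. On [A]
   minus [Z] some [Z + t] contributes the missing [1/(k+1)]; on [Z] the subtracted [k/(k+1)] cancels
   the first term; off [A] everything is nonnegative. *)
have := density_leD (density_leM kk dA) (density_leM (r := k.+1%:R^-1) _ dZ).
rewrite invr_gt0 k1 mulr0 addr0 => /(_ erefl).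
apply: density_le_mono => // x; rewrite !indicE big_split /= sumrN big_const_seq.
rewrite count_predT iter_addr_0 -/k.
have S0 : 0 <= \sum_(t <- Th) \1_Z (x - t) :> R by apply: sumr_ge0.
have [|nA] := boolP (x \in A); last first.
  have -> : (x \in uncovered (j.+1 * K)) = false.
    by apply/negbTE; apply: contra nA => /set_mem/ucA/mem_set.
  have -> : (x \in Z) = false.
    by apply/negbTE; apply: contra nA => /set_mem/ZA/mem_set.
  by rewrite mulr0 mul0rn subr0 add0r mulr_ge0// invr_ge0 ltW.
move=> /set_mem/AZ[t tTh /mem_set Zt].
have S1 : 1 <= \sum_(t <- Th) \1_Z (x - t) :> R.
  rewrite (big_rem t)//= indicE Zt lerDl; exact: sumr_ge0.
have [xZ|xZ] := boolP (x \in Z).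
  have -> : (x \in uncovered (j.+1 * K)) = false.
    by apply/negbTE/negP => /set_mem/ucZ; apply; exact/set_mem.
  rewrite mulr1.
  have -> : 1 - k.+1%:R^-1 = k%:R * k.+1%:R^-1 :> R.
    by rewrite -[in RHS](addrK 1 k%:R) natr1 mulrBl divff ?gt_eqF// mul1r.
  rewrite -[false%:R]/(0 : R) -[true%:R *+ k]/(k%:R : R) [k%:R / _]mulrC -mulrDr.
  by rewrite mulr_ge0 ?invr_ge0 ?(ltW k1)// addrCA subrr addr0.
rewrite -[true%:R]/(1 : R) -[false%:R]/(0 : R) mul0rn subr0 mulr1.
rewrite (@le_trans _ _ 1)//; first by case: (_ \in _).
rewrite -addrA lerDl addrC subr_ge0.
by rewrite ler_peMr// invr_ge0 ltW.
Qed.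

Lemma density_le_sum_translate (phi : V -> R) c (s : seq V) :
  density_le phi c ->
  density_le (fun x => \sum_(t <- s) phi (x + t)) ((size s)%:R * c).
Proof.
move=> Hphi; elim: s => [|t s IH].
  apply: (density_le_mono (psi := fun=> 0) _ (lexx _)); last first.
    by rewrite mul0r; exact: density_le_cst.
  by move=> x; rewrite big_nil.
have := density_leD (density_le_translate t Hphi) IH.
apply: density_le_mono => [x|]; first by rewrite big_cons.
by rewrite /= -natr1 mulrDl mul1r addrC.
Qed.

(** A point within [r] of an uncovered tile enters that tile after one of finitely many translations
    [Th]. Their number does not depend on the level, so it only multiplies a geometrically decaying
    density. *)
Lemma density_bad (r eps : R) : 0 < eps -> exists n, density_le
  (\1_[set y | exists U, [/\ T U, ~ Pn n U & exists2 z, tsupp U z & `|z - y| < r]]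
   : V -> R) eps.
Proof.
move=> eps0; have [K [k Hk]] := density_contraction.
have Hj j : density_le (\1_(uncovered (j * K)) : V -> R) ((1 - k.+1%:R^-1) ^+ j).
  elim: j => [|j /Hk]; last by rewrite exprS.
  rewrite expr0; apply: (density_le_mono (psi := fun=> 1) _ (lexx _)).
    by move=> x; rewrite indicE; case: (_ \in _).
  exact: density_le_cst.
have [r1 r10 thT] := T_thick; have [D D0 diamT] := T_diameter.
have [Th HTh] := ball_totally_bounded d (D + r) r10.
have q0 : 0 <= 1 - k.+1%:R^-1 :> R by rewrite subr_ge0 invf_le1// ler1n.
have q1 : 1 - k.+1%:R^-1 < 1 :> R by rewrite ltrBlDr ltrDl invr_gt0.
have e1 : 0 < eps / (size Th).+1%:R by rewrite divr_gt0.
have [j Hjj] := vanishing_expr q0 q1 e1.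
exists (j * K)%N.
have := density_le_sum_translate Th (Hj j).
apply: density_le_mono => [x|].
  rewrite indicE; case: (boolP (_ \in _)) => [|_]; last exact: sumr_ge0.
  move=> /set_mem[U [TU nPU [z Uz zx]]]; have [p Hp] := thT U TU.
  have Up : tsupp U p by apply: Hp; rewrite subrr normr0.
  have [|t tTh pxt] := HTh (p - x).
    rewrite -(subrKA z) (le_trans (ler_normD _ _))// lerD//; last exact: ltW.
    exact: diamT TU Up Uz.
  rewrite (big_rem t)//= indicE mem_set; first by rewrite lerDl sumr_ge0.
  exists U; split=> //; apply: Hp.
  by rewrite distrC opprD addrA.
have := Hjj j (leqnn _); rewrite ltr_pdivlMr// => /ltW; apply: le_trans.
by rewrite mulrC ler_wpM2l ?exprn_ge0// ler_nat.
Qed.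

End SelfAffine.

(** * Positions of elements of the hull *)

Section Hull.
Variables (R : realType) (d : nat) (Lab : finType).
Local Notation V := 'rV[R]_d.
Local Notation tile := (tile R d Lab).
Variable T : set tile.
Implicit Types (S : set tile) (M : set V).

Lemma sqnorm_eball (y : V) (r : R) : eball 0 r y <-> sqnorm y < r ^+ 2.
Proof. by rewrite /eball /= subr0. Qed.

(** The Euclidean ball of radius [1/eps] contains the sup-norm ball of that radius divided by
    [d.+1]. *)
Lemma lm_close_agree eps S S' : 0 < eps -> lm_close eps S S' ->
  exists y y', [/\ `|y| < eps, `|y'| < eps &
    agree (eps^-1 / d.+1%:R) (ptr S y) (ptr S' y')].
Proof.
move=> eps0 [y [y' [ye [y'e E]]]]; exists y, y'; split.
- exact: norm_lt_sqnorm.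
- exact: norm_lt_sqnorm.
move=> U [z Uz zr].
have mU : tsupp U `&` eball 0 eps^-1 !=set0.
  exists z; split=> //; apply/sqnorm_eball.
  have := sqnorm_lt_norm _ zr; rewrite divfK ?pnatr_eq0//; apply.
  by rewrite divr_gt0// invr_gt0.
split=> SU.
  by have [] : pcap (ptr S' y') (eball 0 eps^-1) U by rewrite -E.
by have [] : pcap (ptr S y) (eball 0 eps^-1) U by rewrite E.
Qed.

Lemma agree_lm_close eps r S S' y : 0 < eps -> `|y| * d.+1%:R < eps ->
  eps^-1 <= r -> agree r S (ptr S' y) -> lm_close eps S S'.
Proof.
move=> eps0 ye er H; exists 0, y; split.
  by rewrite /sqnorm /dotv big1 ?exprn_gt0// => i _; rewrite mxE mul0r.
split.
  have ye' : `|y| < eps / d.+1%:R by rewrite ltr_pdivlMr.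
  have := sqnorm_lt_norm _ ye'; rewrite divfK ?pnatr_eq0//; apply.
  by rewrite divr_gt0.
rewrite ptr0; apply/seteqP; split=> U [SU [z [Uz]]] /sqnorm_eball zr.
  split; last by exists z; split=> //; exact/sqnorm_eball.
  apply/H => //; exists z => //; apply: lt_le_trans er.
  by apply: norm_lt_sqnorm => //; rewrite invr_gt0.
split; last by exists z; split=> //; exact/sqnorm_eball.
apply/H => //; exists z => //; apply: lt_le_trans er.
by apply: norm_lt_sqnorm => //; rewrite invr_gt0.
Qed.

Lemma agree_subr r S S' x : agree (r + `|x|) (ptr S x) S' ->
  agree r S (ptr S' (- x)).
Proof.
move=> H; rewrite -(ptr0 S) -(subrr x) -ptrD; apply: agree_tr.
by rewrite normrN.
Qed.

(** Agreement is exact: both small vectors of [lm_close] are absorbed into the translation of [T],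
    at the cost of at most 1 in the radius. *)
Lemma hull_agree S r : hull T S -> exists w, agree r S (ptr T w).
Proof.
pose a := `|r| + 1; have a0 : 0 < a by rewrite ltr_wpDl.
pose eps := (a * d.+1%:R)^-1; have eps0 : 0 < eps by rewrite invr_gt0 mulr_gt0.
move=> /(_ _ eps0)[x /(lm_close_agree eps0)[y [y' [ye y'e]]]].
rewrite ptrD /eps invrK mulfK ?pnatr_eq0// => H.
have eps1 : eps <= 1.
  by rewrite invf_le1 ?mulr_gt0// -[leLHS]mulr1 ler_pM// ?ler1n// lerDr.
exists (x + y' - y); rewrite -ptrD; apply: agree_subr.
apply: agree_le H; rewrite /a lerD//.
  exact: ler_norm.
by rewrite (le_trans (ltW ye)).
Qed.

Lemma agree_hull S : (forall r, exists w, agree r S (ptr T w)) -> hull T S.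
Proof.
move=> H eps eps0; have [w Hw] := H eps^-1; exists w.
apply: (@agree_lm_close eps eps^-1 _ _ 0) => //.
  by rewrite normr0 mul0r.
by rewrite ptr0.
Qed.

Lemma hull_ptr S x : hull T S -> hull T (ptr S x).
Proof.
move=> hS; apply: agree_hull => r; have [w Hw] := hull_agree (r + `|x|) hS.
by exists (w + x); rewrite -ptrD; exact: agree_tr.
Qed.

Definition subgroup M := M 0 /\ forall x y, M x -> M y -> M (x - y).

Lemma subgroupN M x : subgroup M -> M x -> M (- x).
Proof. by move=> [M0 MB] Mx; rewrite -sub0r; exact: MB. Qed.

Lemma subgroupD M x y : subgroup M -> M x -> M y -> M (x + y).
Proof.
by move=> gM Mx My; rewrite -(opprK y); apply: gM.2 => //; exact: subgroupN.
Qed.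

(* The position of a translate of [T] modulo [M] can be read off its patch on a ball of some fixed radius. *)
Definition recognizable M := exists rho, forall w w',
  agree rho (ptr T w) (ptr T w') -> M (w - w').

(* [w] is the position modulo [M] of the element [S] of the hull. *)
Definition position M S (w : V) := exists r0, forall r, r0 <= r ->
  forall w', agree r S (ptr T w') -> M (w' - w).

Lemma position_exists M S : recognizable M -> hull T S ->
  exists w, position M S w.
Proof.
move=> [rho Hrho] /(hull_agree rho)[w Hw]; exists w, rho => r rr w' Hw'.
apply: Hrho; apply: agree_trans Hw; apply: agree_sym; exact: agree_le Hw'.
Qed.

Lemma position_agree M S w r : position M S w -> hull T S ->
  exists2 w', agree r S (ptr T w') & M (w' - w).
Proof.
move=> [r0 Hr0] /(hull_agree (Num.max r r0))[w' Hw']; exists w'.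
  by apply: agree_le Hw'; rewrite le_max lexx.
by apply: Hr0 Hw'; rewrite le_max lexx orbT.
Qed.

Lemma position_unique M S w w' : subgroup M -> hull T S ->
  position M S w -> position M S w' -> M (w - w').
Proof.
move=> gM hS [r Hr] [r' Hr'].
have [v Hv] := hull_agree (Num.max r r') hS.
have := Hr _ _ _ Hv; rewrite le_max lexx => /(_ erefl) Mv.
have := Hr' _ _ _ Hv; rewrite le_max lexx orbT => /(_ erefl) Mv'.
rewrite (_ : w - w' = (v - w') - (v - w)); first exact: gM.2.
vec.
Qed.

Lemma position_sub M M' S w : M `<=` M' -> position M S w -> position M' S w.
Proof. by move=> MM' [r Hr]; exists r => r' rr' w' /(Hr _ rr')/MM'. Qed.

Lemma positionD M S w v : subgroup M -> position M S w -> M v ->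
  position M S (w + v).
Proof.
move=> gM [r Hr] Mv; exists r => r' rr' w' /(Hr _ rr') H.
by rewrite opprD addrA; exact: gM.2.
Qed.

Lemma position_ptr M S w x : position M S w -> position M (ptr S x) (w + x).
Proof.
move=> [r Hr]; exists (r + `|x|) => r' rr' w' H.
have : M (w' - x - w).
  apply: (Hr (r' - `|x|)); first by rewrite lerBrDr.
  by rewrite -ptrD; apply: agree_subr; rewrite subrK.
by rewrite opprD addrA addrAC.
Qed.

(** If [S + y] and [S' + y'] agree on the recognition ball, their positions coincide modulo [M], so
    those of [S] and [S'] differ by [y - y']. The scale [e] depends only on the recognition radius,
    not on [S]. *)
Lemma position_continuous M : subgroup M -> recognizable M ->
  exists2 e, 0 < e & forall eps S S' w, 0 < eps -> eps <= e ->
    hull T S -> hull T S' -> lm_close eps S S' -> position M S w ->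
    exists2 x, `|x| < 2 * eps & position M S' (w + x).
Proof.
move=> gM [rho Hrho]; pose a := `|rho| + 1.
have a0 : 0 < a by rewrite ltr_wpDl.
have e0 : 0 < (a * d.+1%:R)^-1 by rewrite invr_gt0 mulr_gt0.
exists (a * d.+1%:R)^-1 => // eps S S' w eps0 epse hS hS'.
move=> /(lm_close_agree eps0)[y [y' [ye y'e H]]] pS.
have Hrhoy : agree rho (ptr S y) (ptr S' y').
  apply: agree_le H; apply: (@le_trans _ _ a).
    by rewrite (le_trans (ler_norm _))// lerDl.
  by rewrite ler_pdivlMr// -[leLHS]invrK lef_pV2.
have [w' pS'] := position_exists (ex_intro _ rho Hrho) hS'.
have [v Hv Mv] := position_agree rho (position_ptr y pS) (hull_ptr y hS).
have [v' Hv' Mv'] := position_agree rho (position_ptr y' pS') (hull_ptr y' hS').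
have Mvv' : M (v - v').
  apply: Hrho; apply: (agree_trans (agree_sym Hv)).
  exact: agree_trans Hrhoy Hv'.
exists (y - y').
  by rewrite (le_lt_trans (ler_normB _ _))// mulr_natl mulr2n ltrD.
rewrite (_ : w + _ = w' + ((v - v') - (v - (w + y)) + (v' - (w' + y')))); last by vec.
apply: positionD => //; apply: subgroupD => //; exact: gM.2.
Qed.

Hypothesis gT : good T.
Variable L : set V.
Local Notation Pn := (Per T L).
Local Notation M := (period T L).
Hypotheses (lL : is_lattice L) (gM : subgroup M) (recM : recognizable M).

Definition bad (r : R) (w : V) :=
  exists U, [/\ T U, ~ Pn U & meets (tr U w) r].

(** Every tile of [T + w] meeting the ball is then periodic, and [M] carries periodic tiles to tiles
    of [T]; by [agree_sub] this one inclusion is enough. *)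
Lemma not_bad_agree r w x : ~ bad r w -> M x ->
  agree r (ptr T w) (ptr T (w + x)).
Proof.
move=> nb Mx; apply: agree_sub; [exact: good_ptr..|].
move=> U /ptrE TU mU; apply/ptrE; rewrite opprD -trD.
have PU : Pn (tr U (- w)).
  apply: contrapT => nPU; apply: nb; exists (tr U (- w)).
  by rewrite trNK.
by apply: (subgroupN gM Mx).
Qed.

(** Hence [bad r w] depends on [w] modulo [M] only, and [Bad] does not depend on the position chosen
    for [S]. *)
Lemma bad_period r w x : M x -> bad r w -> bad r (w + x).
Proof.
move=> Mx bw; apply: contrapT => nb; move: bw => [U [TU nPU mU]].
have H := not_bad_agree nb (subgroupN gM Mx); rewrite addrK in H.
have Tx : T (tr U (- x)).
  have /(H _ mU)/ptrE : ptr T w (tr U w) by exists U.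
  by rewrite trD opprD addrA subrr add0r.
apply: nb; exists (tr U (- x)); split=> //.
  move=> PU; apply: nPU; rewrite -(trNK U x).
  exact: period_Per.
by rewrite trD addrCA addNr addr0.
Qed.

Lemma bad_open r w : bad r w -> exists2 e, 0 < e &
  forall x, `|x| < e -> bad r (w + x).
Proof.
move=> [U [TU nPU [y Uy yr]]]; exists (r - `|y|); first by rewrite subr_gt0.
move=> x xr; exists U; split=> //; exists (y + x).
  by rewrite -trD; apply/mem_tr; rewrite addrK.
by rewrite (le_lt_trans (ler_normD _ _))// -ltrBrDl.
Qed.

Definition Bad r : set (set tile) :=
  [set S | hull T S /\ exists2 w, position M S w & bad r w].

Lemma Bad_position r S w : Bad r S -> position M S w -> bad r w.
Proof.
move=> [hS [w' pw' bw']] pw; rewrite (_ : w = w' + (w - w')); last by vec.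
by apply: bad_period => //; exact: position_unique pw pw'.
Qed.

Lemma Bad_open r : hull_open T (Bad r).
Proof.
split=> [S []//|S [hS [w pw bw]]].
have [e e0 He] := bad_open bw; have [e' e'0 He'] := position_continuous gM recM.
exists (Num.min (e / 2) e'); first by rewrite lt_min e'0 divr_gt0.
move=> S' [hS' SS']; split=> //.
have [||x xe px] := He' _ S S' w _ _ hS hS' SS' pw.
- by rewrite lt_min e'0 divr_gt0.
- by rewrite ge_min lexx orbT.
exists (w + x) => //; apply: He; rewrite (lt_le_trans xe)//.
rewrite -ler_pdivlMl// mulrC; by rewrite ge_min lexx.
Qed.

End Hull.

(** * Approximation in mean square by an algebra of functions *)

Section SquareApproximation.
Context {disp : measure_display} {X : measurableType disp} {R : realType}.
Variable mu : probability X R.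
Variable Alg : set (X -> R).
Hypotheses (Alg_cst : forall c, Alg (fun=> c))
  (AlgD : forall u v, Alg u -> Alg v -> Alg (fun x => u x + v x))
  (AlgM : forall u v, Alg u -> Alg v -> Alg (fun x => u x * v x))
  (Alg_meas : forall u, Alg u -> measurable_fun setT u)
  (Alg_bnd : forall u, Alg u -> exists2 c, 0 < c & forall x, `|u x| <= c).
Implicit Types (f g u v : X -> R).

(** The square of the L^2 norm, used throughout so that no roots appear. *)
Definition norm2 f : \bar R := (\int[mu]_x ((f x) ^+ 2)%:E)%E.

Definition approximable f := forall eps : R, 0 < eps ->
  exists2 u, Alg u & (norm2 (fun x => f x - u x)%R < eps%:E)%E.

Lemma measurable_sqr f : measurable_fun setT f ->
  measurable_fun setT (fun x => ((f x) ^+ 2)%:E).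
Proof. by move=> mf; apply/measurable_EFinP; exact: measurable_funX. Qed.

Lemma norm2_le (c : R) f g : 0 <= c -> measurable_fun setT f -> measurable_fun setT g ->
  (forall x, (f x) ^+ 2 <= c * (g x) ^+ 2) -> (norm2 f <= c%:E * norm2 g)%E.
Proof.
move=> c0 mf mg H; rewrite /norm2 -ge0_integralZl//; last 2 first.
- exact: measurable_sqr.
- by move=> x _; rewrite lee_fin sqr_ge0.
apply: ge0_le_integral => //.
- by move=> x _; rewrite lee_fin sqr_ge0.
- exact: measurable_sqr.
- by apply: measurable_funeM; exact: measurable_sqr.
by move=> x _; rewrite -EFinM lee_fin.
Qed.

Lemma norm2D f g : measurable_fun setT f -> measurable_fun setT g ->
  (norm2 (fun x => f x + g x)%R <= 2%:E * norm2 f + 2%:E * norm2 g)%E.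
Proof.
move=> mf mg; rewrite /norm2 -!ge0_integralZl//; last 4 first.
- exact: measurable_sqr.
- by move=> x _; rewrite lee_fin sqr_ge0.
- exact: measurable_sqr.
- by move=> x _; rewrite lee_fin sqr_ge0.
rewrite -ge0_integralD//; last 4 first.
- by move=> x _; rewrite -EFinM lee_fin mulr_ge0// sqr_ge0.
- by apply: measurable_funeM; exact: measurable_sqr.
- by move=> x _; rewrite -EFinM lee_fin mulr_ge0// sqr_ge0.
- by apply: measurable_funeM; exact: measurable_sqr.
apply: ge0_le_integral => //.
- by move=> x _; rewrite lee_fin sqr_ge0.
- by apply: measurable_sqr; exact: measurable_funD.
- by apply: emeasurable_funD; apply: measurable_funeM; exact: measurable_sqr.
move=> x _; rewrite -!EFinM -EFinD lee_fin.
have := sqr_ge0 (f x - g x); nra.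
Qed.

(** Since the square of a sum is at most twice the sum of the squares, [eps / 8] for each term
    leaves [eps / 2]. *)
Lemma norm2D_lt f g eps : measurable_fun setT f -> measurable_fun setT g ->
  0 < eps -> (norm2 f < (eps / 8)%:E)%E -> (norm2 g < (eps / 8)%:E)%E ->
  (norm2 (fun x => f x + g x)%R < eps%:E)%E.
Proof.
move=> mf mg e0 fe ge; apply: (le_lt_trans (norm2D mf mg)).
apply: (@le_lt_trans _ _ (2%:E * (eps / 8)%:E + 2%:E * (eps / 8)%:E)%E).
  by apply: leeD; apply: lee_wpmul2l => //; exact: ltW.
by rewrite -!EFinM -EFinD lte_fin; lra.
Qed.

Lemma approximable_Alg u : Alg u -> approximable u.
Proof.
move=> Au eps e0; exists u => //; rewrite /norm2.
under eq_integral do rewrite subrr expr0n.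
by rewrite integral0 lte_fin.
Qed.

Lemma approximable_closed f : measurable_fun setT f ->
  (forall eps, 0 < eps -> exists g, [/\ measurable_fun setT g, approximable g &
     (norm2 (fun x => f x - g x)%R < eps%:E)%E]) -> approximable f.
Proof.
move=> mf H eps e0; have e8 : 0 < eps / 8 by rewrite divr_gt0.
have [g [mg /(_ _ e8)[u Au gu] fg]] := H _ e8.
exists u => //; have mu' := Alg_meas Au.
have := norm2D_lt (measurable_funB mf mg) (measurable_funB mg mu') e0 fg gu.
by congr (_ < _)%E; apply: eq_integral => x _; rewrite subrKA.
Qed.

Lemma approximable_dominated (F : nat -> X -> R) f (h : X -> \bar R) :
  (forall n, measurable_fun setT (F n)) -> measurable_fun setT f ->
  (forall x, (F n x @[n --> \oo] --> f x)) ->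
  mu.-integrable setT h -> (forall n x, ((F n x - f x) ^+ 2)%:E <= h x)%E ->
  (forall n, approximable (F n)) -> approximable f.
Proof.
move=> mF mf Ff ih Fh aF; apply: approximable_closed => // eps e0.
have mFf n : measurable_fun setT (fun x => ((F n x - f x) ^+ 2)%:E).
  by apply: measurable_sqr; exact: measurable_funB.
have [||_ _] := @dominated_convergence _ X R mu setT measurableT
  (fun n x => ((F n x - f x) ^+ 2)%:E) (fun=> 0%E) h mFf (measurable_cst _) _ ih _.
- apply: aeW => x _; apply: cvg_EFin; first exact: nearW.
  rewrite [X in _ --> X](_ : _ = (f x - f x) ^+ 2); last by rewrite subrr expr0n.
  apply: (@cvg_comp _ _ _ (fun n => F n x - f x) (fun y => y ^+ 2)); last exact: exprn_continuous.
  by apply: cvgB => //; exact: cvg_cst.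
- by apply: aeW => x n _; rewrite gee0_abs ?lee_fin ?sqr_ge0.
rewrite integral0.
move=> /fine_cvgP[fin /cvgrPdist_lt/(_ eps e0)].
move: fin => [N1 _ HN1] [N2 _ HN2].
pose n := maxn N1 N2; exists (F n); split => //.
have : norm2 (fun x => F n x - f x)%R \is a fin_num by apply: HN1; exact: leq_maxl.
have := HN2 n (leq_maxr _ _); rewrite /= sub0r normrN.
rewrite ger0_norm; last by rewrite fine_ge0// integral_ge0// => x _; rewrite lee_fin sqr_ge0.
move=> Hn fin; rewrite (_ : norm2 _ = norm2 (fun x => F n x - f x)%R).
  by rewrite -(fineK fin) lte_fin.
by apply: eq_integral => x _; rewrite -sqrrN opprB.
Qed.

Lemma approximableD f g : measurable_fun setT f -> measurable_fun setT g ->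
  approximable f -> approximable g -> approximable (fun x => f x + g x).
Proof.
move=> mf mg af ag eps e0; have e8 : 0 < eps / 8 by rewrite divr_gt0.
have [u Au fu] := af _ e8; have [v Av gv] := ag _ e8.
exists (fun x => u x + v x); first exact: AlgD.
have := norm2D_lt (measurable_funB mf (Alg_meas Au))
  (measurable_funB mg (Alg_meas Av)) e0 fu gv.
congr (_ < _)%E; apply: eq_integral => x _; congr EFin; rewrite /=; ring.
Qed.

Lemma norm2_mul_lt c f g eps : 0 < c -> 0 < eps ->
  measurable_fun setT f -> measurable_fun setT g ->
  (forall x, `|f x| <= c) -> (norm2 g < (eps / c ^+ 2)%:E)%E ->
  (norm2 (fun x => f x * g x)%R < eps%:E)%E.
Proof.
move=> c0 e0 mf mg fc gc.
have H : (norm2 (fun x => f x * g x)%R <= (c ^+ 2)%:E * norm2 g)%E.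
  apply: norm2_le => //; [exact: sqr_ge0|exact: measurable_funM|].
  move=> x; rewrite exprMn ler_wpM2r ?sqr_ge0// -[leLHS]real_normK ?num_real//.
  by rewrite ler_pXn2r// ?nnegrE// ltW.
apply: (le_lt_trans H).
apply: (@lt_le_trans _ _ ((c ^+ 2)%:E * (eps / c ^+ 2)%:E)%E).
  by rewrite lte_pmul2l// lte_fin exprn_gt0.
by rewrite -EFinM mulrC divfK// gt_eqF// exprn_gt0.
Qed.

(** Write [f g - u v = f (g - v) + v (f - u)]. The approximant [v] is chosen first, because its
    bound fixes how closely [u] must approximate [f]. *)
Lemma approximableM c f g : 0 < c -> (forall x, `|f x| <= c) ->
  measurable_fun setT f -> measurable_fun setT g ->
  approximable f -> approximable g -> approximable (fun x => f x * g x).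
Proof.
move=> c0 fc mf mg af ag eps e0; have e8 : 0 < eps / 8 by rewrite divr_gt0.
have [v Av gv] := ag _ (divr_gt0 e8 (exprn_gt0 2 c0)).
have [b b0 vb] := Alg_bnd Av.
have [u Au fu] := af _ (divr_gt0 e8 (exprn_gt0 2 b0)).
exists (fun x => u x * v x); first exact: AlgM.
have mu' := Alg_meas Au; have mv := Alg_meas Av.
have h1 := norm2_mul_lt c0 e8 mf (measurable_funB mg mv) fc gv.
have h2 := norm2_mul_lt b0 e8 mv (measurable_funB mf mu') vb fu.
have := norm2D_lt (measurable_funM mf (measurable_funB mg mv))
  (measurable_funM mv (measurable_funB mf mu')) e0 h1 h2.
congr (_ < _)%E; apply: eq_integral => x _; congr EFin; rewrite /=; ring.
Qed.

Lemma approximableZ (c : R) f : measurable_fun setT f -> approximable f ->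
  approximable (fun x => c * f x).
Proof.
move=> mf af; have c0 : 0 < `|c| + 1 by rewrite ltr_wpDl.
apply: (approximableM c0 _ (measurable_cst c) mf (approximable_Alg (Alg_cst c)) af).
by move=> x; rewrite lerDl.
Qed.

Lemma approximable_sum (I : Type) (s : seq I) (F : I -> X -> R) :
  (forall i, measurable_fun setT (F i)) -> (forall i, approximable (F i)) ->
  approximable (fun x => \sum_(i <- s) F i x).
Proof.
move=> mF aF; elim: s => [|i s IH].
  under eq_fun do rewrite big_nil; apply: approximable_Alg; exact: Alg_cst.
under eq_fun do rewrite big_cons.
by apply: approximableD => //; exact: measurable_sum.
Qed.

Lemma approximable_bounded_limit (F : nat -> X -> R) f (c : R) :
  (forall n, measurable_fun setT (F n)) -> measurable_fun setT f ->
  (forall x, (F n x @[n --> \oo] --> f x)) ->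
  (forall n x, `|F n x| <= c) -> (forall x, `|f x| <= c) ->
  (forall n, approximable (F n)) -> approximable f.
Proof.
move=> mF mf Ff Fc fc aF.
apply: (@approximable_dominated F f (cst ((c + c) ^+ 2)%:E)) => //.
  by apply: finite_measure_integrable_cst.
move=> n x; rewrite lee_fin -[leLHS]real_normK ?num_real//.
have H : `|F n x - f x| <= c + c by rewrite (le_trans (ler_normB _ _))// lerD.
by rewrite ler_pXn2r ?nnegrE// (le_trans _ H).
Qed.

Definition approx_set (A : set X) := measurable A /\ approximable (\1_A : X -> R).

Lemma indic_le1 (A : set X) x : `|\1_A x : R| <= 1.
Proof. by rewrite indicE; case: (_ \in _); rewrite ?normr1 ?normr0. Qed.

Lemma approx_setI A B : approx_set A -> approx_set B -> approx_set (A `&` B).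
Proof.
move=> [mA aA] [mB aB]; split; first exact: measurableI.
have -> : \1_(A `&` B) = (fun x => \1_A x * \1_B x) :> (X -> R).
  by apply/funext => x; rewrite indicI.
by apply: (@approximableM 1) => //; exact: indic_le1.
Qed.

Lemma approx_setT : approx_set setT.
Proof.
by split=> //; rewrite indicT; apply: approximable_Alg; exact: Alg_cst.
Qed.

Lemma approx_setC A : approx_set A -> approx_set (~` A).
Proof.
move=> [mA aA]; split; first exact: measurableC.
have -> : \1_(~` A) = (fun x => 1 + -1 * \1_A x) :> (X -> R).
  apply/funext => x; rewrite !indicE in_setC; case: (x \in A) => /=.
    by rewrite mulr1 subrr.
  by rewrite mulr0 addr0.
apply: approximableD => //.
- by apply: measurable_funM.
- by apply: approximable_Alg; exact: Alg_cst.
- by apply: approximableZ.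
Qed.

Lemma approx_setU A B : approx_set A -> approx_set B -> approx_set (A `|` B).
Proof.
by move=> aA aB; rewrite -(setCK (A `|` B)) setCU; apply/approx_setC/approx_setI;
  exact: approx_setC.
Qed.

Lemma approx_set_bigcup (F : nat -> set X) :
  (forall n, approx_set (F n)) -> approx_set (\bigcup_n F n).
Proof.
move=> aF; have mU : measurable (\bigcup_n F n).
  by apply: bigcup_measurable => n _; case: (aF n).
pose G n := \big[setU/set0]_(i < n) F i.
have aG n : approx_set (G n).
  rewrite /G; elim/big_ind: _ => //; last exact: approx_setU.
  by rewrite -setCT; apply/approx_setC/approx_setT.
split=> //.
apply: (@approximable_bounded_limit (fun n => \1_(G n)) _ 1) => //.
- by move=> n; apply: measurable_indic; case: (aG n).
- move=> x; have [[n _ Fnx]|nx] := pselect ((\bigcup_n F n) x).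
    rewrite [X in _ --> X]indicE mem_set; last by exists n.
    apply: cvg_near_cst.
    exists n.+1 => // k /= nk; rewrite indicE mem_set//.
    by rewrite /G -bigcup_mkord; exists n => //=.
  rewrite [X in _ --> X]indicE memNset//; apply: cvg_near_cst.
  apply: nearW => k; rewrite indicE memNset// /G.
  by rewrite -bigcup_mkord => -[j /= _ Fj]; apply: nx; exists j.
- by move=> n x; exact: indic_le1.
- by move=> x; exact: indic_le1.
- by move=> n; case: (aG n).
Qed.

Lemma approx_set_ae A B : approx_set A -> measurable B -> A `<=` B ->
  mu (B `\` A) = 0%E -> approx_set B.
Proof.
move=> [mA aA] mB AB BA0; split=> //.
apply: approximable_closed; first exact: measurable_indic.
move=> eps e0; exists \1_A; split=> //.
have mBA : measurable (B `\` A) by exact: measurableD.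
rewrite /norm2 (_ : (\int[mu]_x _)%E = (\int[mu]_x (\1_(B `\` A) x)%:E)%E).
  suff -> : (\int[mu]_x (\1_(B `\` A) x)%:E)%E = 0%E by rewrite lte_fin.
  by rewrite integral_indic// setIT; exact: BA0.
apply: eq_integral => x _; congr EFin; rewrite !indicE in_setD.
have [xA|] := boolP (x \in A).
  by rewrite mem_set ?subrr ?expr0n//; apply: AB; exact/set_mem.
by case: (x \in B) => _; rewrite /= ?subr0 ?expr1n ?expr0n.
Qed.

Lemma approx_set_full A : measurable A -> mu A = 1%E -> approx_set A.
Proof.
move=> mA A1; rewrite -(setCK A); apply: approx_setC.
apply: (@approx_set_ae set0) => //.
- by rewrite -setCT; apply/approx_setC/approx_setT.
- exact: measurableC.
- by rewrite setD0 probability_setC// A1 subee.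
Qed.

End SquareApproximation.

(** * Explicit polynomials converging pointwise to a step function on the unit interval *)

Section StepPolynomials.
Variable R : realType.
Implicit Types (q y : R).

Lemma bernoulli y k : -1 <= y -> 1 + k%:R * y <= (1 + y) ^+ k.
Proof.
move=> y1; elim: k => [|k IH]; first by rewrite mul0r addr0 expr0.
have y0 : 0 <= 1 + y by rewrite -lerBlDl sub0r.
rewrite exprS; apply: le_trans (ler_wpM2l y0 IH).
rewrite -natr1; have : 0 <= k%:R * y ^+ 2 by rewrite mulr_ge0 ?sqr_ge0.
nra.
Qed.

(** Bernoulli replaces [1 + k y] by [(1 + y)^k], and [(1 - y)(1 + y) <= 1]. *)
Lemma bernoulli_inv y k : 0 <= y -> y <= 1 ->
  (1 - y) ^+ k * (1 + k%:R * y) <= 1.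
Proof.
move=> y0 y1; have b : 0 <= (1 - y) ^+ k by rewrite exprn_ge0// subr_ge0.
have H := bernoulli k (le_trans (lerN10 R) y0).
rewrite (le_trans (ler_wpM2l b H))// -exprMn exprn_ile1//; nra.
Qed.

(** With [y = q^(2n)] and exponent [N = n 4^n], the power [(1 - y)^N] is governed by
    [N y = n (2q)^(2n)], which tends to infinity for [q >= 1/2] and to 0 below. The factor [n] makes
    the jump point [q = 1/2] fall on the upper side. *)
Definition step_poly q n := 1 - (1 - q ^+ (2 * n)) ^+ (n * 4 ^ n).

Lemma step_poly_mul q n : (n * 4 ^ n)%:R * q ^+ (2 * n) = n%:R * ((2 * q) ^+ n * (2 * q) ^+ n).
Proof.
rewrite natrM natrX exprM -mulrA -exprMn -exprMn; congr (_ * _ ^+ _).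
rewrite expr2; ring.
Qed.

Lemma step_poly_itv q n : 0 <= q <= 1 -> 0 <= step_poly q n <= 1.
Proof.
move=> /andP[q0 q1]; have y0 : 0 <= q ^+ (2 * n) by exact: exprn_ge0.
have y1 : q ^+ (2 * n) <= 1 by exact: exprn_ile1.
by rewrite /step_poly gerBl subr_ge0 exprn_ge0 ?exprn_ile1 ?subr_ge0 ?gerBl.
Qed.

Lemma step_poly_cvg q : 0 <= q <= 1 ->
  step_poly q n @[n --> \oo] --> (if 2^-1 <= q then 1 else 0 : R).
Proof.
move=> q01; have /andP[q0 q1] := q01; apply/cvgrPdist_lt => eps eps0.
have y0 n : 0 <= q ^+ (2 * n) by exact: exprn_ge0.
have y1 n : q ^+ (2 * n) <= 1 by exact: exprn_ile1.
case: ifPn => [q2|]; last rewrite -ltNge => q2.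
  exists (Num.bound eps^-1) => // n /= nN.
  have -> : 1 - step_poly q n = (1 - q ^+ (2 * n)) ^+ (n * 4 ^ n).
    by rewrite /step_poly subKr.
  have b : 0 <= (1 - q ^+ (2 * n)) ^+ (n * 4 ^ n).
    by rewrite exprn_ge0// subr_ge0.
  have kn : n%:R <= (n * 4 ^ n)%:R * q ^+ (2 * n).
    rewrite step_poly_mul ler_peMr// -exprMn exprn_ege1//.
    have : 1 <= 2 * q by lra.
    nra.
  rewrite ger0_norm//.
  have H := bernoulli_inv (n * 4 ^ n) (y0 n) (y1 n).
  have eN : eps^-1 < n%:R.
    apply: (lt_le_trans (archi_boundP _)); first by rewrite invr_ge0 ltW.
    by rewrite ler_nat.
  have n0 : 0 < (n%:R : R) by apply: lt_trans eN; rewrite invr_gt0.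
  have : (1 - q ^+ (2 * n)) ^+ (n * 4 ^ n) * n%:R <= 1.
    apply: le_trans H; rewrite ler_wpM2l//; lra.
  rewrite -ler_pdivlMr// => h; apply: (le_lt_trans h).
  by rewrite ltr_pdivrMr// -ltr_pdivrMl// mulr1.
have r0 : 0 <= 2 * q by lra.
have r1 : 2 * q < 1 by lra.
have p0 : 0 < 1 - 2 * q by lra.
have [N HN] := vanishing_expr r0 r1 (mulr_gt0 eps0 p0).
exists N => // n /= /HN Hn; rewrite sub0r normrN.
have /andP[s0 _] := step_poly_itv n q01; rewrite ger0_norm//.
have H1 : step_poly q n <= n%:R * ((2 * q) ^+ n * (2 * q) ^+ n).
  have := @bernoulli (- q ^+ (2 * n)) (n * 4 ^ n).
  rewrite lerN2 => /(_ (y1 n)); rewrite mulrN step_poly_mul /step_poly; lra.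
(* This bounds [n (2q)^n] by [1 / (1 - 2q)]; the remaining factor [(2q)^n] tends to 0. *)
have H2 : (2 * q) ^+ n * (1 + n%:R * (1 - 2 * q)) <= 1.
  rewrite -[X in X ^+ n](subKr 1); apply: bernoulli_inv; lra.
have rn0 : 0 <= (2 * q) ^+ n by exact: exprn_ge0.
rewrite (le_lt_trans H1)// -(@ltr_pM2r _ (1 - 2 * q))//.
apply: le_lt_trans Hn.
rewrite (_ : _ * _ * _ = (2 * q) ^+ n * ((2 * q) ^+ n * (n%:R * (1 - 2 * q)))); last by ring.
rewrite -[leRHS]mulr1 ler_wpM2l//; lra.
Qed.

End StepPolynomials.

(** * From level sets of the algebra to all square-integrable functions *)

Section LevelSets.
Import HBNNSimple.
Context {disp : measure_display} {X : measurableType disp} {R : realType}.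
Variable mu : probability X R.
Variable Alg : set (X -> R).
Hypotheses (Alg_cst : forall c, Alg (fun=> c))
  (AlgD : forall u v, Alg u -> Alg v -> Alg (fun x => u x + v x))
  (AlgM : forall u v, Alg u -> Alg v -> Alg (fun x => u x * v x))
  (Alg_meas : forall u, Alg u -> measurable_fun setT u)
  (Alg_bnd : forall u, Alg u -> exists2 c, 0 < c & forall x, `|u x| <= c).

Lemma AlgX u n : Alg u -> Alg (fun x => u x ^+ n).
Proof.
move=> Au; elim: n => [|n IH]; first exact: Alg_cst.
under eq_fun do rewrite exprS; exact: AlgM.
Qed.

Lemma AlgZB (a b : R) u : Alg u -> Alg (fun x => a - b * u x).
Proof.
move=> Au; under eq_fun do rewrite -mulNr.
by apply: AlgD; [exact: Alg_cst|apply: AlgM => //; exact: Alg_cst].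
Qed.

Lemma approx_set_level u : Alg u -> approx_set mu Alg [set x | 0 <= u x].
Proof.
move=> Au; have [c c0 uc] := Alg_bnd Au.
(* The affine map from [[-c, c]] to [[0, 1]] sending 0 to the jump point [1/2]; the double sign
   matches the shape of [AlgZB]. *)
pose q x := 2^-1 - - (2 * c)^-1 * u x.
have Aq : Alg q by exact: AlgZB.
have q01 x : 0 <= q x <= 1.
  have := uc x; rewrite ler_norml => /andP[h1 h2].
  have e : q x = (c + u x) / (2 * c) by rewrite /q; field; rewrite gt_eqF.
  have h3 : 0 <= c + u x by lra.
  rewrite e divr_ge0 ?mulr_ge0 ?(ltW c0)//=.
  by rewrite ler_pdivrMr ?mulr_gt0// mul1r mulr_natl mulr2n lerD2l.
have AF n : Alg (fun x => step_poly (q x) n).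
  rewrite /step_poly; under eq_fun do rewrite -[X in 1 - X]mul1r.
  apply: AlgZB; apply: AlgX; under eq_fun do rewrite -[X in 1 - X]mul1r.
  by apply: AlgZB; exact: AlgX.
have ind x : (\1_[set x | 0 <= u x] x : R) = if 2^-1 <= q x then 1 else 0.
  have -> : (2^-1 <= q x) = (0 <= u x).
    by rewrite /q mulNr opprK lerDl pmulr_rge0// invr_gt0 mulr_gt0.
  rewrite indicE; case: ifPn => h; first by rewrite mem_set.
  by rewrite memNset//; apply/negP.
have mL : measurable [set x | 0 <= u x].
  rewrite -[X in measurable X]setTI.
  rewrite [X in _ `&` X](_ : _ = u @^-1` `[0, +oo[%classic).
    exact: (Alg_meas Au).
  by apply/seteqP; split=> x /=; rewrite in_itv /= andbT.
split=> //.
apply: (@approximable_bounded_limit _ _ _ mu Alg Alg_meas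
  (fun n x => step_poly (q x) n) _ 1) => //.
- by move=> n; exact: Alg_meas.
- by move=> x; rewrite ind; exact: step_poly_cvg.
- by move=> n x; have /andP[h1 h2] := step_poly_itv n (q01 x); rewrite ger0_norm.
- by move=> x; exact: indic_le1.
- by move=> n; exact: approximable_Alg.
Qed.

Hypothesis approx_all : forall A : set X, measurable A -> approx_set mu Alg A.

Lemma approximable_nnsfun (f : {nnsfun X >-> R}) : approximable mu Alg (fun x => f x).
Proof.
have -> : (fun x => f x) = (fun x => \sum_(y <- fset_set (range f)) y * \1_(f @^-1` [set y]) x).
  by apply/funext => x; rewrite fimfunE fsbig_finite.
apply: approximable_sum => // y.
  by apply: measurable_funM.
apply: approximableZ => //; apply: (approx_all _).2; exact: measurable_sfunP.
Qed.

Lemma approximable_ge0 (f : X -> R) : measurable_fun setT f ->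
  (forall x, 0 <= f x) -> (norm2 mu f < +oo)%E -> approximable mu Alg f.
Proof.
move=> mf f0 fL2.
have mfE : measurable_fun setT (EFin \o f) by exact/measurable_EFinP.
pose F := nnsfun_approx measurableT mfE.
have Fle n x : F n x <= f x.
  by rewrite -lee_fin /F nnsfun_approxE; apply: le_approx => // y _; rewrite lee_fin.
apply: (@approximable_dominated _ _ _ mu Alg Alg_meas (fun n => F n) f
  (fun x => ((f x) ^+ 2)%:E)) => //.
- move=> x; have f0E y : setT y -> (0 <= (EFin \o f) y)%E by rewrite lee_fin.
  have := @cvg_nnsfun_approx _ _ _ _ measurableT _ mfE f0E x Logic.I.
  by move=> /fine_cvgP[].
- apply/integrableP; split; first exact: measurable_sqr.
  under eq_integral do rewrite gee0_abs ?lee_fin ?sqr_ge0//.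
  exact: fL2.
- move=> n x; rewrite lee_fin -sqrrN opprB.
  rewrite ler_pXn2r// ?nnegrE ?subr_ge0//.
  by rewrite gerBl.
- by move=> n; exact: approximable_nnsfun.
Qed.

Lemma approximable_L2 (f : X -> R) : measurable_fun setT f ->
  (norm2 mu f < +oo)%E -> approximable mu Alg f.
Proof.
move=> mf fL2.
have mN : measurable_fun setT (fun x => - f x) by exact: measurableT_comp.
have part (g : X -> R) : measurable_fun setT g -> (norm2 mu g < +oo)%E ->
    approximable mu Alg (fun x => Num.max (g x) 0).
  move=> mg gL2; have mm : measurable_fun setT (fun x => Num.max (g x) 0).
    by apply: measurable_maxr.
  apply: approximable_ge0 => //.
    by move=> x; rewrite le_max lexx orbT.
  apply: le_lt_trans gL2; rewrite -[leRHS]mul1e; apply: norm2_le => // x.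
  rewrite mul1r /Num.max; case: ifPn => // _.
  by rewrite expr0n sqr_ge0.
have fE : f = (fun x => Num.max (f x) 0 + -1 * Num.max (- f x) 0).
  by apply/funext => x; rewrite /Num.max oppr_lt0; case: ltrgt0P => h; rewrite ?h; ring.
rewrite fE.
have m1 : measurable_fun setT (fun x => Num.max (f x) 0) by exact: measurable_maxr.
have m2 : measurable_fun setT (fun x => Num.max (- f x) 0) by exact: measurable_maxr.
apply: approximableD => //; first exact: measurable_funM.
- exact: part.
- apply: approximableZ => //; apply: part => //.
  rewrite /norm2; under eq_integral do rewrite sqrrN.
  exact: fL2.
Qed.

End LevelSets.

(** * The invariant measure on the hull *)

Section HullMeasure.
Variables (R : realType) (d : nat) (Lab : finType).
Local Notation V := 'rV[R]_d.
Local Notation tile := (tile R d Lab).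
Variable T : set tile.
Local Notation X := (hullSpace T).
Implicit Types (S : set tile).

(** Puts both shifts of [lm_close] on one side, so that they commute with a translation of the two
    patches; this is what continuity of the action needs. *)
Lemma lm_close_small (r eps : R) : 0 < eps -> exists2 e, 0 < e &
  forall S S', lm_close e S S' ->
    exists2 y, `|y| * d.+1%:R < eps & agree r S (ptr S' y).
Proof.
move=> eps0; pose a := (`|r| + 1) * d.+1%:R; pose b := eps / (2 * d.+1%:R).
have a0 : 0 < a by rewrite mulr_gt0// ltr_wpDl.
have b0 : 0 < b by rewrite divr_gt0// mulr_gt0.
pose e := Num.min (Num.min 1 a^-1) b.
have e0 : 0 < e by rewrite !lt_min ltr01 invr_gt0 a0.
have [e1 ea eb] : [/\ e <= 1, e <= a^-1 & e <= b].
  by rewrite !ge_min !lexx !orbT.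
exists e => // S S' /(lm_close_agree e0)[y [y' [ye y'e H]]].
exists (y' - y).
  apply: (@lt_le_trans _ _ (2 * e * d.+1%:R)).
    rewrite ltr_pM2r// (le_lt_trans (ler_normB _ _))//.
    by rewrite mulr_natl mulr2n ltrD.
  have -> : eps = 2 * b * d.+1%:R.
    by rewrite [2 * b]mulrC -mulrA divfK// mulf_neq0// pnatr_eq0.
  by rewrite ler_pM2r// ler_pM2l.
rewrite -ptrD; apply: agree_subr; apply: agree_le H.
apply: (@le_trans _ _ (`|r| + 1)).
  by rewrite lerD// ?ler_norm// (le_trans (ltW ye)).
by rewrite ler_pdivlMr// -[leLHS]invrK lef_pV2// posrE invr_gt0.
Qed.

Lemma hull_open_measurable (U : set X) : hull_open T U -> measurable U.
Proof. by move=> oU; apply: sub_sigma_algebra. Qed.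

Lemma hull_open_hull : hull_open T (hull T).
Proof.
split=> [S //|S _].
by exists 1; [exact: ltr01|move=> S' []].
Qed.

Lemma hull_measurable : measurable (hull T : set X).
Proof. by apply: hull_open_measurable; exact: hull_open_hull. Qed.

Lemma hull_ptrE S x : hull T (ptr S x) -> hull T S.
Proof. by move=> /(hull_ptr (- x)); rewrite ptrD subrr ptr0. Qed.

Lemma shift_open x (U : set X) : hull_open T U ->
  hull_open T (Defs.shift (T := T) x @^-1` U).
Proof.
move=> [UT oU]; split=> [S /UT|S US]; first exact: hull_ptrE.
have [eps eps0 HU] := oU _ US.
have [e e0 He] := @lm_close_small (eps^-1 + `|x|) _ eps0.
exists e => // S' [hS' /He[y ye H]]; apply: HU; split; first exact: hull_ptr.
apply: (@agree_lm_close _ _ _ _ eps^-1 _ _ y) => //.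
by rewrite /Defs.shift ptrD addrC -ptrD; exact: agree_tr.
Qed.

Lemma measurable_shift x : measurable_fun setT (Defs.shift (T := T) x).
Proof.
have := @measurability _ _ X X setT (Defs.shift (T := T) x) (hull_open T) erefl.
apply=> _ [U oU <-].
by rewrite setTI; apply: hull_open_measurable; exact: shift_open.
Qed.

(** The generating sets all lie in the hull, so its complement is not subdivided by the
    sigma-algebra and [f] has to be constant there. *)
Lemma measurable_locally_continuous (f : X -> R) (c : R) :
  (forall S, ~ hull T S -> f S = c) ->
  (forall S eps, hull T S -> 0 < eps -> exists2 e, 0 < e &
    forall S', hull T S' -> lm_close e S S' -> `|f S' - f S| < eps) ->
  measurable_fun setT f.
Proof.
move=> fc fcont; apply: (measurability _ (RGenOInfty.measurableE R)) => _ [_ [a ->] <-].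
rewrite setTI; pose A := [set S | hull T S /\ a < f S].
have mA : measurable (A : set X).
  apply: hull_open_measurable; split=> [S []//|S [hS aS]].
  have [|e e0 He] := fcont S (f S - a) hS; first by rewrite subr_gt0.
  exists e => // S' [hS' /(He _ hS')]; rewrite distrC => H; split=> //.
  by have := le_lt_trans (ler_norm _) H; rewrite ltrD2l ltrN2.
have [ac|ca] := ltP a c.
  rewrite [X in measurable X](_ : _ = A `|` ~` hull T).
    by apply: measurableU => //; apply: measurableC; exact: hull_measurable.
  apply/seteqP; split=> S /=; rewrite in_itv /= andbT.
    by have [hS|nS] := pselect (hull T S); [left|right].
  by move=> [[]//|/fc ->].
rewrite [X in measurable X](_ : _ = A)//.
apply/seteqP; split=> S /=; rewrite in_itv /= andbT; last by case.
have [hS|/fc ->] := pselect (hull T S); first by [].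
by rewrite ltNge ca.
Qed.

Variable mu : probability X R.
Hypothesis muinv : translation_invariant mu.

Lemma integral_shift x (f : X -> \bar R) : measurable_fun setT f ->
  (forall S, 0 <= f S)%E ->
  (\int[mu]_S f (Defs.shift x S) = \int[mu]_S f S)%E.
Proof.
move=> mf f0.
have := @ge0_integral_pushforward _ _ X X R (Defs.shift x) (measurable_shift x) mu setT f
  measurableT mf (fun S _ => f0 S).
rewrite preimage_setT => <-.
apply: eq_measure_integral => [|mS A mA _]; first exact: measurable_shift.
by rewrite -(muinv x mA).
Qed.

(** Integrating the pointwise bound, each of the [size s] terms contributes [mu A] by invariance.
    Here densities become measures. *)
Lemma measure_le_average (A : set X) (s : seq V) (c : R) : measurable A -> s != [::] ->
  (forall S, \sum_(x <- s) \1_A (Defs.shift x S) <= c * (size s)%:R) ->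
  (mu A <= c%:E)%E.
Proof.
move=> mA s0 H.
have mf x : measurable_fun setT (fun S : X => (\1_A (Defs.shift x S))%:E : \bar R).
  apply/measurable_EFinP.
  apply: (measurableT_comp (f := \1_A : X -> R)); last exact: measurable_shift.
  exact: measurable_indic.
have n0 : 0 < (size s)%:R :> R.
  by rewrite ltr0n; case: s s0 {H}.
have E : (\int[mu]_S (\sum_(x <- s) (\1_A (Defs.shift x S))%:E) = (size s)%:R%:E * mu A)%E.
  rewrite ge0_integral_sum//.
  have Ex x : (\int[mu]_S (\1_A (Defs.shift x S))%:E = mu A)%E.
    rewrite (@integral_shift x (fun S => (\1_A S)%:E)).
    - by rewrite integral_indic// setIT.
    - by apply/measurable_EFinP; exact: measurable_indic.
    - by move=> S; rewrite lee_fin.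
  under eq_bigr do rewrite Ex.
  rewrite -(fineK (fin_num_measure mu A mA)) sumEFin big_const_seq count_predT.
  by rewrite iter_addr_0 -EFinM mulr_natl.
have : (\int[mu]_S (\sum_(x <- s) (\1_A (Defs.shift x S))%:E) <= (c * (size s)%:R)%:E)%E.
  rewrite -[leRHS]mule1 -(@probability_setT _ _ _ mu) -integral_cst//.
  apply: ge0_le_integral => //.
  - by move=> S _; apply: sume_ge0 => x _; rewrite lee_fin.
  - exact: emeasurable_sum.
  by move=> S _; rewrite sumEFin lee_fin.
rewrite E -(fineK (fin_num_measure mu A mA)) -EFinM !lee_fin mulrC.
by rewrite ler_pM2r.
Qed.

End HullMeasure.

(** * Continuous eigenfunctions *)

Section Characters.
Variables (R : realType) (d : nat) (Lab : finType).
Local Notation V := 'rV[R]_d.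
Local Notation tile := (tile R d Lab).
Variable T : set tile.
Local Notation X := (hullSpace T).
Implicit Types (S : set tile) (a b : V).

Lemma dotvC (x y : V) : dotv x y = dotv y x.
Proof. by apply: eq_bigr => i _; rewrite mulrC. Qed.

Lemma dotvDl (x y a : V) : dotv (x + y) a = dotv x a + dotv y a.
Proof. by rewrite -big_split /=; apply: eq_bigr => i _; rewrite mxE mulrDl. Qed.

Lemma dotvNl (x a : V) : dotv (- x) a = - dotv x a.
Proof. by rewrite /dotv -sumrN; apply: eq_bigr => i _; rewrite mxE mulNr. Qed.

Lemma dotvBl (x y a : V) : dotv (x - y) a = dotv x a - dotv y a.
Proof. by rewrite dotvDl dotvNl. Qed.

Lemma dotv0l (a : V) : dotv 0 a = 0.
Proof. by rewrite /dotv big1// => i _; rewrite mxE mul0r. Qed.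

Lemma dotv_bounded (a : V) : exists2 c, 0 < c &
  forall x : V, `|dotv x a| <= c * `|x|.
Proof.
exists (1 + \sum_i `|a ord0 i|); first by rewrite ltr_pwDl// sumr_ge0.
move=> x; rewrite mulrDl mul1r (@le_trans _ _ ((\sum_i `|a ord0 i|) * `|x|))//.
  rewrite (le_trans (ler_norm_sum _ _ _))// mulr_suml; apply: ler_sum => i _.
  by rewrite normrM mulrC ler_wpM2l// rV_norm_coord.
by rewrite lerDr.
Qed.

Lemma expiD (s t : R) : expi (s + t) = expi s * expi t.
Proof. by rewrite /expi cosD sinD; congr Complex; rewrite addrC mulrC [X in _ + X]mulrC. Qed.

Lemma expi0 : expi 0 = 1 :> R[i].
Proof. by rewrite /expi cos0 sin0. Qed.

Lemma expi_int (z : R) : z \is a Num.int -> expi (2 * pi * z) = 1.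
Proof.
have Hn (n : nat) : expi (2 * pi * n%:R) = 1 :> R[i].
  elim: n => [|n IH]; first by rewrite mulr0 expi0.
  rewrite -(natr1 n) mulrDr mulr1 expiD IH mul1r /expi.
  by rewrite mulr_natl -[pi *+ 2]add0r cosD2pi sinD2pi cos0 sin0.
move=> /intrP[[n|n] ->]; first exact: Hn.
rewrite NegzE mulrNz mulrN.
have := expiD (2 * pi * n.+1%:R) (- (2 * pi * n.+1%:R)).
by rewrite subrr expi0 Hn mul1r => <-.
Qed.

Definition kerZ a : set V := [set x | dotv x a \is a Num.int].

Lemma kerZ_subgroup a : subgroup (kerZ a).
Proof.
split=> [|x y xa ya]; rewrite /kerZ /=; first by rewrite dotv0l rpred0.
by rewrite dotvBl rpredB.
Qed.

(** [kerZ a] is used instead of a lattice of periods: intersections of recognizable subgroups are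
    recognizable, so frequencies add without comparing the lattices of different levels. *)
Definition freq a := recognizable T (kerZ a).

Lemma recognizableI (M N : set V) : recognizable T M -> recognizable T N ->
  recognizable T (M `&` N).
Proof.
move=> [r Hr] [r' Hr']; exists (Num.max r r') => w w' H; split.
  by apply: Hr; apply: agree_le H; rewrite le_max lexx.
by apply: Hr'; apply: agree_le H; rewrite le_max lexx orbT.
Qed.

Lemma recognizable_sub (M N : set V) : M `<=` N -> recognizable T M ->
  recognizable T N.
Proof. by move=> MN [r Hr]; exists r => w w' /Hr/MN. Qed.

Lemma freq0 : freq 0.
Proof.
by exists 0 => w w' _; rewrite /kerZ /= dotvC dotv0l rpred0.
Qed.

Lemma kerZD a b : kerZ a `&` kerZ b `<=` kerZ (a + b).
Proof.
by move=> x [xa xb]; rewrite /kerZ /= dotvC dotvDl ![dotv _ x]dotvC rpredD.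
Qed.

Lemma freqD a b : freq a -> freq b -> freq (a + b).
Proof. by move=> fa fb; apply: recognizable_sub (recognizableI fa fb); exact: kerZD. Qed.

Lemma kerZN a : kerZ a `<=` kerZ (- a).
Proof. by move=> x xa; rewrite /kerZ /= dotvC dotvNl dotvC rpredN. Qed.

Lemma freqN a : freq a -> freq (- a).
Proof. by apply: recognizable_sub; exact: kerZN. Qed.

Definition hull_pos a (S : X) : V :=
  if pselect (hull T S) then xget 0 (position T (kerZ a) S) else 0.

(* Outside the hull, a set of measure 0, [chi a] is set to 1 so that multiplicativity holds everywhere. *)
Definition chi a (S : X) : R[i] := expi (- (2 * pi * dotv (hull_pos a S) a)).

Lemma chi_position a S w : freq a -> hull T S -> position T (kerZ a) S w ->
  chi a S = expi (- (2 * pi * dotv w a)).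
Proof.
move=> fa hS pw; rewrite /chi /hull_pos; case: pselect => //= _.
have px : position T (kerZ a) S (xget 0 (position T (kerZ a) S)).
  by apply: xgetPex; exists w.
move: px; set x := xget _ _ => px.
have : kerZ a (w - x) by exact: (position_unique (kerZ_subgroup a) hS pw px).
rewrite /kerZ /= dotvBl => /expi_int H.
rewrite -(mulr1 (expi (- (_ * dotv w a)))) -H -expiD; congr expi; ring.
Qed.

Lemma chi_out a S : ~ hull T S -> chi a S = 1.
Proof.
by move=> nS; rewrite /chi /hull_pos; case: pselect => //= _; rewrite dotv0l mulr0 oppr0 expi0.
Qed.

Lemma chiD a b S : freq a -> freq b -> chi (a + b) S = chi a S * chi b S.
Proof.
move=> fa fb; have [hS|nS] := pselect (hull T S); last first.
  by rewrite !chi_out// mulr1.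
have [w pw] := position_exists (recognizableI fa fb) hS.
rewrite (@chi_position (a + b) S w) ?(@chi_position a S w) ?(@chi_position b S w)//.
- by rewrite -expiD; congr expi; rewrite dotvC dotvDl ![dotv _ w]dotvC; ring.
- by apply: position_sub pw => x [].
- by apply: position_sub pw => x [].
- exact: freqD.
- by apply: position_sub pw; exact: kerZD.
Qed.

Lemma chi0 S : chi 0 S = 1.
Proof. by rewrite /chi dotvC dotv0l mulr0 oppr0 expi0. Qed.

Lemma conjc_expi t : (expi t)^*%C = expi (- t) :> R[i].
Proof. by rewrite /expi cosN sinN. Qed.

Lemma chiN a S : freq a -> chi (- a) S = (chi a S)^*%C.
Proof.
move=> fa; have [hS|nS] := pselect (hull T S); last first.
  by rewrite !chi_out// conjc1.
have [w pw] := position_exists fa hS.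
rewrite (@chi_position a S w)// (@chi_position (- a) S w)//.
- by rewrite conjc_expi; congr expi; rewrite dotvC dotvNl dotvC; ring.
- exact: freqN.
- by apply: position_sub pw; exact: kerZN.
Qed.

Lemma chi_shift a x S : freq a -> hull T S ->
  chi a (Defs.shift x S) = expi (- (2 * pi * dotv x a)) * chi a S.
Proof.
move=> fa hS; have [w pw] := position_exists fa hS.
rewrite (@chi_position a S w)// (@chi_position a _ (w + x))//.
- by rewrite -expiD; congr expi; rewrite dotvDl; ring.
- exact: hull_ptr.
- exact: position_ptr.
Qed.

Lemma expi_continuous (s eps : R) : 0 < eps -> exists2 e, 0 < e &
  forall t, `|t| < e -> `|cos (s + t) - cos s| < eps /\ `|sin (s + t) - sin s| < eps.
Proof.
move=> eps0.
have /cvgrPdist_lt/(_ eps eps0)/nbhs_ballP[e1 /= e10 H1] := @continuous_cos R s.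
have /cvgrPdist_lt/(_ eps eps0)/nbhs_ballP[e2 /= e20 H2] := @continuous_sin R s.
exists (Num.min e1 e2) => [|t]; first by rewrite lt_min e10.
rewrite lt_min => /andP[t1 t2]; rewrite 2!(distrC _ (_ s)); split.
  by apply: H1; rewrite /ball /= opprD addrA subrr sub0r normrN.
by apply: H2; rewrite /ball /= opprD addrA subrr sub0r normrN.
Qed.

Lemma chi_continuous a S eps : freq a -> hull T S -> 0 < eps ->
  exists2 e, 0 < e & forall S', hull T S' -> lm_close e S S' ->
    `|complex.Re (chi a S') - complex.Re (chi a S)| < eps /\
    `|complex.Im (chi a S') - complex.Im (chi a S)| < eps.
Proof.
move=> fa hS eps0.
have [e1 e10 H1] := position_continuous (kerZ_subgroup a) fa.
have [w pw] := position_exists fa hS.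
have [e2 e20 H2] := expi_continuous (- (2 * pi * dotv w a)) eps0.
have [c c0 Hc] := dotv_bounded a.
have k0 : 0 < 2 * pi * c * 2 :> R by rewrite !mulr_gt0// pi_gt0.
(* At closeness [e] the position moves by less than [2 e], hence the phase by less than [2 pi c]
   times [2 e]. *)
exists (Num.min e1 (e2 / (2 * pi * c * 2))).
  by rewrite lt_min e10 divr_gt0.
move=> S' hS' SS'.
have [||x xe px] := H1 _ S S' w _ _ hS hS' SS' pw.
- by rewrite lt_min e10 divr_gt0.
- by rewrite ge_min lexx.
rewrite (@chi_position a S w)// (@chi_position a S' (w + x))//.
rewrite dotvDl mulrDr opprD; apply: H2.
rewrite normrN !normrM (ger0_norm (pi_ge0 R)) ger0_norm//.
apply: (@le_lt_trans _ _ (2 * pi * (c * `|x|))).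
  by rewrite ler_wpM2l// mulr_ge0// pi_ge0.
apply: (@lt_le_trans _ _ (2 * pi * (c * (2 * (e2 / (2 * pi * c * 2)))))).
  rewrite ltr_pM2l ?mulr_gt0 ?pi_gt0// ltr_pM2l// (lt_le_trans xe)//.
  by rewrite ler_pM2l// ge_min lexx orbT.
rewrite (_ : 2 * pi * (c * _) = 2 * pi * c * 2 * (e2 / (2 * pi * c * 2))); last by ring.
by rewrite mulrCA divff ?mulr1// gt_eqF.
Qed.

Lemma measurable_Re_chi a : freq a ->
  measurable_fun setT (fun S : X => complex.Re (chi a S)).
Proof.
move=> fa; apply: (@measurable_locally_continuous _ _ _ _ _ 1).
  by move=> S /chi_out ->.
by move=> S eps hS /(chi_continuous fa hS)[e e0 He]; exists e => // S' hS' /(He _ hS')[].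
Qed.

Lemma measurable_Im_chi a : freq a ->
  measurable_fun setT (fun S : X => complex.Im (chi a S)).
Proof.
move=> fa; apply: (@measurable_locally_continuous _ _ _ _ _ 0).
  by move=> S /chi_out ->.
by move=> S eps hS /(chi_continuous fa hS)[e e0 He]; exists e => // S' hS' /(He _ hS')[].
Qed.

Lemma chi_cnorm2 a S : cnorm2 (chi a S) = 1.
Proof. by rewrite /cnorm2 /chi /expi /= cos2Dsin2. Qed.

Definition trig_poly (f : X -> R[i]) := exists s : seq (R[i] * {a | freq a}),
  forall S, f S = \sum_(p <- s) p.1 * chi (sval p.2) S.

Lemma trig_poly_chi a : freq a -> trig_poly (chi a).
Proof.
by move=> fa; exists [:: (1, exist _ a fa)] => S; rewrite big_seq1 mul1r.
Qed.

Lemma trig_polyD f g : trig_poly f -> trig_poly g ->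
  trig_poly (fun S => f S + g S).
Proof.
by move=> [s Hs] [t Ht]; exists (s ++ t) => S; rewrite big_cat /= Hs Ht.
Qed.

Lemma trig_polyM f g : trig_poly f -> trig_poly g ->
  trig_poly (fun S => f S * g S).
Proof.
move=> [s Hs] [t Ht].
pose mul (p q : R[i] * {a | freq a}) : R[i] * {a | freq a} :=
  (p.1 * q.1, exist _ _ (freqD (svalP p.2) (svalP q.2))).
exists [seq mul p q | p <- s, q <- t] => S.
rewrite Hs Ht big_allpairs_dep mulr_suml; apply: eq_bigr => p _.
rewrite mulr_sumr; apply: eq_bigr => q _ /=.
by rewrite chiD; [rewrite mulrACA|exact: svalP|exact: svalP].
Qed.

Lemma trig_poly_cst c : trig_poly (fun=> c).
Proof.
by exists [:: (c, exist _ 0 freq0)] => S; rewrite big_seq1 /= chi0 mulr1.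
Qed.

(** The approximation argument runs over the reals; stability of [freq] under negation puts the real
    and imaginary parts of characters in this algebra. *)
Definition real_trig_poly (u : X -> R) := trig_poly (fun S => (u S)%:C%C).

Lemma real_trig_cst c : real_trig_poly (fun=> c).
Proof. exact: trig_poly_cst. Qed.

Lemma real_trigD u v : real_trig_poly u -> real_trig_poly v ->
  real_trig_poly (fun S => u S + v S).
Proof.
move=> tu tv; rewrite /real_trig_poly.
by under eq_fun do rewrite rmorphD; exact: trig_polyD.
Qed.

Lemma real_trigM u v : real_trig_poly u -> real_trig_poly v ->
  real_trig_poly (fun S => u S * v S).
Proof.
move=> tu tv; rewrite /real_trig_poly.
by under eq_fun do rewrite rmorphM; exact: trig_polyM.
Qed.

Lemma real_trig_Re a : freq a -> real_trig_poly (fun S => complex.Re (chi a S)).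
Proof.
move=> fa; rewrite /real_trig_poly.
under eq_fun do rewrite ReJ_add -chiN//.
apply: trig_polyM; last exact: trig_poly_cst.
by apply: trig_polyD; apply: trig_poly_chi => //; exact: freqN.
Qed.

Lemma real_trig_Im a : freq a -> real_trig_poly (fun S => complex.Im (chi a S)).
Proof.
move=> fa; rewrite /real_trig_poly.
under eq_fun do rewrite ImJ_sub -chiN// -mulrA -mulN1r.
apply: trig_polyM; last exact: trig_poly_cst.
apply: trig_polyD; first by apply: trig_poly_chi; exact: freqN.
by apply: trig_polyM; [exact: trig_poly_cst|exact: trig_poly_chi].
Qed.

Lemma real_trigE u : real_trig_poly u -> exists s : seq (R[i] * {a | freq a}),
  forall S, u S = \sum_(p <- s) (complex.Re p.1 * complex.Re (chi (sval p.2) S)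
                                 - complex.Im p.1 * complex.Im (chi (sval p.2) S)).
Proof.
move=> [s Hs]; exists s => S.
have -> : u S = complex.Re ((u S)%:C)%C by [].
rewrite Hs raddf_sum; apply: eq_bigr => p _.
by case: (p.1) => x y; case: (chi _ _).
Qed.

Lemma real_trig_measurable u : real_trig_poly u -> measurable_fun setT u.
Proof.
move=> /real_trigE[s Hs]; rewrite (funext Hs).
apply: measurable_sum => p; apply: measurable_funB; apply: measurable_funM => //.
  by apply: measurable_Re_chi; exact: svalP.
by apply: measurable_Im_chi; exact: svalP.
Qed.

Lemma real_trig_bounded u : real_trig_poly u ->
  exists2 c, 0 < c & forall S, `|u S| <= c.
Proof.
move=> /real_trigE[s Hs].
exists (1 + \sum_(p <- s) (`|complex.Re p.1| + `|complex.Im p.1|)).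
  by rewrite ltr_pwDl// sumr_ge0// => p _; rewrite addr_ge0.
move=> S; rewrite Hs (le_trans (ler_norm_sum _ _ _))//.
rewrite (@le_trans _ _ (\sum_(p <- s) (`|complex.Re p.1| + `|complex.Im p.1|)))//.
  apply: ler_sum => p _; rewrite (le_trans (ler_normB _ _))// !normrM.
  have [h1 h2] : `|complex.Re (chi (sval p.2) S)| <= 1 /\
                 `|complex.Im (chi (sval p.2) S)| <= 1.
    by rewrite /chi /expi /=; split; rewrite ler_norml ?cos_geN1 ?cos_le1 ?sin_geN1 ?sin_le1.
  by apply: lerD; rewrite -[leRHS]mulr1 ler_wpM2l.
by rewrite lerDr.
Qed.

End Characters.

(** * Density of the eigenfunctions *)

Section LimitPeriodic.
Variables (R : realType) (d : nat) (Lab : finType).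
Local Notation V := 'rV[R]_d.
Local Notation tile := (tile R d Lab).
Variables (T : set tile) (Ln : nat -> set V).
Local Notation X := (hullSpace T).
Local Notation M n := (period T (Ln n)).
Hypotheses (gT : good T) (lL : forall n, is_lattice (Ln n))
  (gM : forall n, subgroup (M n)) (lM : forall n, is_lattice (M n))
  (rM : forall n, recognizable T (M n))
  (dens : forall r eps : R, 0 < eps -> exists n, density_le
    (\1_[set y | exists U, [/\ T U, ~ Per T (Ln n) U &
       exists2 z, tsupp U z & `|z - y| < r]] : V -> R) eps).
Variable mu : probability X R.
Hypotheses (mu1 : mu (hull T : set X) = 1%E) (muinv : translation_invariant mu).

Lemma measurable_Bad n r : measurable (Bad T (Ln n) r : set X).
Proof. by apply: hull_open_measurable; apply: Bad_open. Qed.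

Lemma measure_Bad r eps : 0 < eps -> exists n, (mu (Bad T (Ln n) r : set X) <= eps%:E)%E.
Proof.
move=> eps0; have e2 : 0 < eps / 2 by rewrite divr_gt0.
have [n /(_ _ e2)[s s0 Hs]] := dens r e2.
(* If [S] has position [w], then [S - x] has position [w - x], which is bad exactly when a
   non-periodic tile of [T] comes within [r] of [- w + x]; hence the signs and the base point
   [- w]. *)
exists n; apply: (@measure_le_average R d Lab T mu muinv _ [seq - x | x <- s]) => //.
- exact: measurable_Bad.
- by case: s s0 {Hs}.
move=> S; rewrite big_map size_map.
have [hS|nS] := pselect (hull T S); last first.
  rewrite big1 ?mulr_ge0 ?(ltW eps0)// => x _; rewrite indicE memNset// => -[/hull_ptrE].
  by [].
have [w pw] := position_exists (rM n) hS.
have := Hs (- w); rewrite -splitr; apply: le_trans; apply: ler_sum => x _.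
rewrite !indicE; have [/set_mem bS|_] := boolP (_ \in Bad T (Ln n) r); last by [].
rewrite mem_set//.
have [U [TU nPU [y Uy yr]]] := Bad_position gT (lL n) (gM n) bS (position_ptr (- x) pw).
exists U; split=> //; exists (y - (w - x)); first by apply/mem_tr.
by rewrite (_ : _ - _ = y)//; vec.
Qed.

Lemma negligible_Bad : mu.-negligible
  (\bigcup_N \bigcap_n (Bad T (Ln n) N%:R : set X)).
Proof.
apply: negligible_bigcup => N.
have mB : measurable (\bigcap_n (Bad T (Ln n) N%:R : set X)).
  by apply: bigcap_measurable => // n _; exact: measurable_Bad.
apply/negligibleP => //; apply/eqP; rewrite eq_le measure_ge0 andbT.
apply/lee_addgt0Pr => eps eps0; rewrite add0e.
have [n Hn] := measure_Bad N%:R eps0; apply: le_trans Hn.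
apply: le_measure; rewrite ?inE//; first exact: measurable_Bad.
by move=> S /(_ n); apply.
Qed.

Local Notation Aset := (approx_set mu (@real_trig_poly R d Lab T)).

Let Alg_cst := @real_trig_cst R d Lab T.
Let AlgD := @real_trigD R d Lab T.
Let AlgM := @real_trigM R d Lab T.
Let Alg_meas := @real_trig_measurable R d Lab T.
Let Alg_bnd := @real_trig_bounded R d Lab T.

Lemma Aset_hull : Aset (hull T).
Proof. by apply: approx_set_full => //; exact: hull_measurable. Qed.

Lemma Aset_floor (u : X -> R) (k : R) z : real_trig_poly (T := T) u ->
  Aset [set S : X | Num.floor (k * u S) = z].
Proof.
move=> tu.
have tl y : real_trig_poly (T := T) (fun S => - y + k * u S).
  by apply: AlgD; [exact: Alg_cst|apply: AlgM => //; exact: Alg_cst].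
rewrite (_ : mkset _ = [set S | 0 <= - z%:~R + k * u S] `&`
                       ~` [set S | 0 <= - (z + 1)%:~R + k * u S]).
  apply: approx_setI => //; first exact: approx_set_level.
  by apply: approx_setC => //; exact: approx_set_level.
apply/seteqP; split=> S /=; rewrite ![- _ + _]addrC !subr_ge0.
  move=> <-; rewrite floor_le; split=> //; apply/negP; rewrite -ltNge.
  by have /andP[] := floor_itv (k * u S).
by move=> [h1 /negP]; rewrite -ltNge => h2; apply: floor_def; rewrite h1.
Qed.

Lemma Aset_forall (I : finType) (F : I -> set X) :
  (forall i, Aset (F i)) -> Aset [set S | forall i, F i S].
Proof.
move=> HF.
have H (s : seq I) : Aset [set S | forall i, i \in s -> F i S].
  elim: s => [|i s IH].
    rewrite (_ : mkset _ = setT); first exact: approx_setT.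
    by apply/seteqP; split.
  rewrite (_ : mkset _ = F i `&` [set S | forall i, i \in s -> F i S]).
    exact: approx_setI.
  apply/seteqP; split=> S /= HS.
    split; first by apply: HS; rewrite mem_head.
    by move=> j js; apply: HS; rewrite inE js orbT.
  by move=> j; rewrite inE => /orP[/eqP ->|/HS.2//]; exact: HS.1.
rewrite (_ : mkset _ = [set S | forall i, i \in enum I -> F i S]) //.
apply/seteqP; split=> S /= HS i; first by move=> _; exact: HS.
by apply: HS; rewrite mem_enum.
Qed.

(** The dual basis of [M n]: being a period becomes integrality of [d] pairings, and the last clause
    converts small errors in the pairings into a short vector. *)
Lemma dual_basis n : exists b : 'I_d -> V,
  (forall x, M n x <-> forall i, dotv x (b i) \is a Num.int) /\
  exists2 c, 0 < c & forall x : V, exists2 y : V,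
    (forall i, dotv y (b i) = x ord0 i) & `|y| <= c * `|x|.
Proof.
have [C uC MC] := (is_latticeP (M n)).1 (lM n).
have E x i : dotv x (\row_j invmx C j i) = (x *m invmx C) ord0 i.
  by rewrite [RHS]mxE /dotv; apply: eq_bigr => j _; rewrite mxE.
exists (fun i => \row_j invmx C j i); split.
  by move=> x; rewrite MC; split=> H i; [rewrite E|rewrite -E].
have [c c0 Hc] := mulmx_bounded C; exists c => // x.
exists (x *m C); last exact: Hc.
by move=> i; rewrite E mulmxK.
Qed.

(** After subtracting the nearest integer the angle lies in [[0, pi]] up to sign, where cosine
    decreases strictly; cutting [eta] at [1/2] keeps the threshold angle there too. *)
Lemma cos_near_int (eta : R) : 0 < eta -> exists2 kappa, 0 < kappa &
  forall t, 1 - kappa < cos (2 * pi * t) ->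
    exists z : int, `|t - z%:~R| < eta.
Proof.
move=> eta0; pose e := Num.min eta 2^-1.
have e0 : 0 < e by rewrite lt_min eta0 /= invr_gt0 ltr0n.
have e2 : e <= 2^-1 by rewrite ge_min lexx orbT.
have pi0 := pi_gt0 R.
have itv (x : R) : 0 <= x -> x <= 2^-1 -> 2 * pi * x \in `[0, pi].
  move=> x0 x2; rewrite in_itv /= !mulr_ge0 ?pi_ge0//=.
  by rewrite -[leRHS]mulr1 [2 * pi]mulrC -mulrA ler_pM2l//; lra.
have ei := itv e (ltW e0) e2.
have ce : cos (2 * pi * e) < 1.
  rewrite -[ltRHS](@cos0 R) ltr_cos ?mulr_gt0//.
  by rewrite in_itv /= lexx pi_ge0.
exists (1 - cos (2 * pi * e)) => [|t]; first by rewrite subr_gt0.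
rewrite subKr => Ht.
pose z := Num.floor (t + 2^-1); exists z.
have /andP[z1 z2] := floor_itv (t + 2^-1); rewrite -/z intrD in z1 z2.
have tz : `|t - z%:~R| <= 2^-1 by rewrite ler_norml; lra.
have cz : cos (2 * pi * t) = cos (2 * pi * `|t - z%:~R|).
  have -> : cos (2 * pi * `|t - z%:~R|) = cos (2 * pi * (t - z%:~R)).
    have [h|h] := lerP 0 (t - z%:~R); first by rewrite ger0_norm.
    by rewrite ltr0_norm// mulrN cosN.
  have [h _] : expi (2 * pi * t) = expi (2 * pi * (t - z%:~R)) :> R[i].
    have {1}-> : t = (t - z%:~R) + z%:~R by rewrite subrK.
    by rewrite mulrDr expiD (expi_int (intr_int _ z)) mulr1.
  exact: h.
apply: (@lt_le_trans _ _ e); last by rewrite ge_min lexx.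
rewrite ltNge; apply/negP => ez; move: Ht; rewrite cz ltNge => /negP; apply.
by rewrite leNgt ltr_cos ?itv ?(ltW e0)// -leNgt ler_pM2l// mulr_gt0.
Qed.

Lemma freq_dual n (b : V) : (forall x, M n x -> dotv x b \is a Num.int) ->
  freq T b.
Proof. by move=> H; apply: recognizable_sub (rM n) => x /H. Qed.

(* Close characters force close positions modulo the periods; when only periodic tiles meet the ball of radius [r], this determines the patch on it up to a small translation. *)
Lemma chi_close n (b : 'I_d -> V) (S : X) (r eps : R) : 0 < eps ->
  (forall x, M n x <-> forall i, dotv x (b i) \is a Num.int) ->
  (exists2 c, 0 < c & forall x : V, exists2 y : V,
    (forall i, dotv y (b i) = x ord0 i) & `|y| <= c * `|x|) ->
  hull T S -> ~ Bad T (Ln n) r S -> eps^-1 <= r ->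
  exists2 kappa, 0 < kappa & forall S' : X, hull T S' ->
    (forall i, `|complex.Re (chi (b i) S') - complex.Re (chi (b i) S)| < kappa /\
               `|complex.Im (chi (b i) S') - complex.Im (chi (b i) S)| < kappa) ->
    lm_close eps S S'.
Proof.
move=> eps0 Mb [c c0 Hc] hS nB er.
have fb i : freq T (b i) by apply: (@freq_dual n) => x /Mb.
have [w pw] := position_exists (rM n) hS.
have nb : ~ bad T (Ln n) r w by move=> bw; apply: nB; split=> //; exists w.
(* Chosen so that [c * eta * d.+1] is [eps / 2]: [c] comes from the dual basis, [d.+1] from the
   change of norm. *)
pose eta := eps / (2 * c * d.+1%:R).
have k0 : 0 < 2 * c * d.+1%:R by rewrite !mulr_gt0.
have eta0 : 0 < eta by rewrite divr_gt0.
have [kap kap0 Hkap] := cos_near_int eta0.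
(* Errors below 1 dominate their squares, and [2 - 2 cos (al - be)] is the sum of the squared errors
   in cosine and sine, hence below [2 kap]. *)
exists (Num.min 1 kap) => [|S' hS' HS']; first by rewrite lt_min ltr01.
have [w' pw'] := position_exists (rM n) hS'.
have subb i : M n `<=` kerZ (b i) by move=> x /Mb; exact.
have /choice[z Hz] : forall i, exists z : int, `|dotv (w' - w) (b i) - z%:~R| < eta.
  move=> i; apply: Hkap; have [] := HS' i.
  rewrite (chi_position (fb i) hS (position_sub (subb i) pw)).
  rewrite (chi_position (fb i) hS' (position_sub (subb i) pw')).
  rewrite /expi /= !lt_min => /andP[a1 a2] /andP[b1 b2].
  set al := - (2 * pi * dotv w (b i)) in a1 a2 b1 b2 *.
  set be := - (2 * pi * dotv w' (b i)) in a1 a2 b1 b2 *.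
  have -> : 2 * pi * dotv (w' - w) (b i) = al - be by rewrite dotvBl /al /be; ring.
  rewrite cosB.
  have h1 := cos2Dsin2 al; have h2 := cos2Dsin2 be.
  have q1 : (cos be - cos al) ^+ 2 < kap.
    rewrite -real_normK ?num_real// expr2 (le_lt_trans _ a2)//.
    by rewrite ler_piMr// ltW.
  have q2 : (sin be - sin al) ^+ 2 < kap.
    rewrite -real_normK ?num_real// expr2 (le_lt_trans _ b2)//.
    by rewrite ler_piMr// ltW.
  nra.
have [x Hx xn] := Hc (\row_i (dotv (w' - w) (b i) - (z i)%:~R)).
have Mx : M n (w' - w - x).
  by apply/Mb => i; rewrite dotvBl Hx mxE subKr intr_int.
have xeps : `|x| * d.+1%:R < eps.
  have xe : `|x| <= c * eta.
    rewrite (le_trans xn)// ler_pM2l//; apply/rV_norm_le => [|i]; first exact: ltW.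
    by rewrite mxE ltW.
  apply: (@le_lt_trans _ _ (c * eta * d.+1%:R)); first by rewrite ler_pM2r.
  have E : eta * (2 * c * d.+1%:R) = eps by rewrite divfK// gt_eqF.
  have p : 0 < c * eta * d.+1%:R := mulr_gt0 (mulr_gt0 c0 eta0) (ltr0Sn _ _).
  rewrite -[ltRHS]E (_ : eta * _ = c * eta * d.+1%:R + c * eta * d.+1%:R); last by ring.
  by rewrite ltrDl.
apply: (@agree_lm_close _ _ _ _ r _ _ (- x)) => //; first by rewrite normrN.
have [v Hv Mv] := position_agree r pw hS.
have [v' Hv' Mv'] := position_agree (r + `|- x|) pw' hS'.
apply: (agree_trans Hv); apply: (@agree_trans _ _ _ _ _ (ptr T w)).
  apply: agree_sym; rewrite -(subrK w v) addrC.
  exact: (not_bad_agree gT (gM n) nb).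
apply: (@agree_trans _ _ _ _ _ (ptr T (v' - x))).
  rewrite (_ : v' - x = w + ((v' - w') + (w' - w - x))); last by vec.
  by apply: (not_bad_agree gT (gM n) nb); exact: (subgroupD (gM n) Mv' Mx).
by apply: agree_sym; rewrite -ptrD; exact: agree_tr.
Qed.

(** A cell fixes the [d] basic characters of level [n] up to [1/k], so there are countably many
    cells. If [S] in [U] is not [Bad] at level [n] for a large enough ball, [chi_close] places a
    fine cell around [S] inside [U]; the cells contained in [U] therefore exhaust it up to
    [negligible_Bad]. *)
Lemma Aset_open (U : set X) : hull_open T U -> Aset U.
Proof.
move=> oU; have /choice[b Hb] := dual_basis.
have fb n i : freq T (b n i).
  by apply: (@freq_dual n) => x; have [/(_ x)[H _] _] := Hb n => /H.
pose idx := (nat * nat * {ffun 'I_d -> int * int})%type.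
pose cell (j : idx) : set X := hull T `&` [set S : X | forall i,
  Num.floor (j.1.2%:R * complex.Re (chi (b j.1.1 i) S)) = (j.2 i).1 /\
  Num.floor (j.1.2%:R * complex.Im (chi (b j.1.1 i) S)) = (j.2 i).2].
have Acell j : Aset (cell j).
  apply: approx_setI => //; first exact: Aset_hull.
  apply: (@Aset_forall _ (fun i => [set S : X |
    Num.floor (j.1.2%:R * complex.Re (chi (b j.1.1 i) S)) = (j.2 i).1] `&`
    [set S : X | Num.floor (j.1.2%:R * complex.Im (chi (b j.1.1 i) S)) = (j.2 i).2])).
  move=> i; apply: approx_setI => //; apply: Aset_floor.
    exact: real_trig_Re.
  exact: real_trig_Im.
pose F (N : nat) : set X := if choice.unpickle N is Some j
  then (if pselect (cell j `<=` U) then cell j else set0) else set0.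
have A0 : Aset set0.
  by rewrite -setCT; apply: approx_setC => //; exact: approx_setT.
have AF N : Aset (F N).
  by rewrite /F; case: choice.unpickle => [j|//]; case: pselect => /= _.
have FU : \bigcup_N F N `<=` U.
  move=> S [N _]; rewrite /F; case: choice.unpickle => // j.
  by case: pselect => //= cU; exact: cU.
have mU := hull_open_measurable oU.
have AUF := approx_set_bigcup Alg_cst AlgD AlgM Alg_meas Alg_bnd AF.
apply: (approx_set_ae Alg_meas AUF mU FU).
have [mF _] := AUF.
apply/negligibleP; first exact: measurableD.
apply: negligibleS negligible_Bad => S [US nFS].
have hS : hull T S by exact: oU.1.
have [eps eps0 Heps] := oU.2 S US.
apply: contrapT => nB; apply: nFS.
pose N := Num.bound eps^-1.
have epsN : eps^-1 <= N%:R.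
  by apply: ltW; apply: archi_boundP; rewrite invr_ge0 ltW.
have [n nBn] : exists n, ~ Bad T (Ln n) N%:R S.
  apply: contrapT => /forallNP H; apply: nB; exists N => // n _.
  by apply: contrapT; exact: H.
have [kap kap0 Hkap] := chi_close eps0 (Hb n).1 (Hb n).2 hS nBn epsN.
pose k := (Num.bound kap^-1).
have kk : kap^-1 < k%:R by apply: archi_boundP; rewrite invr_ge0 ltW.
have k0 : 0 < k%:R :> R by apply: lt_trans kk; rewrite invr_gt0.
pose j : idx := (n, k, [ffun i => (Num.floor (k%:R * complex.Re (chi (b n i) S)),
   Num.floor (k%:R * complex.Im (chi (b n i) S)))]).
have Sj : cell j S by split=> // i /=; rewrite ffunE.
have fl (x y : R) : Num.floor (k%:R * x) = Num.floor (k%:R * y) -> `|x - y| < kap.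
  move=> E; have /andP[x1 x2] := floor_itv (k%:R * x).
  have /andP[y1 y2] := floor_itv (k%:R * y).
  rewrite E intrD in x1 x2; rewrite intrD in y2.
  rewrite -(ltr_pM2l k0) -{1}(ger0_norm (ltW k0)) -normrM mulrBr.
  apply: (@lt_trans _ _ 1); first by rewrite ltr_norml; lra.
  by rewrite -ltr_pdivrMr// div1r.
have cU : cell j `<=` U.
  move=> S' [hS' HS']; apply: Heps; split=> //; apply: Hkap => // i.
  have := HS' i; rewrite /= ffunE /= => -[h1 h2].
  by split; apply: fl.
exists (choice.pickle j) => //; rewrite /F choice.pickleK.
by case: pselect.
Qed.

Lemma Aset_measurable (A : set X) : measurable A -> Aset A.
Proof.
move=> mA; apply: (mA [set B | Aset B]); split; last exact: Aset_open.
split.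
- by rewrite -setCT; apply: approx_setC => //; exact: approx_setT.
- by move=> B AB; rewrite setTD; exact: approx_setC.
- by move=> F AF; exact: approx_set_bigcup.
Qed.

End LimitPeriodic.

(** * Orthonormality of the characters and completeness in L^2 *)

Section Spectrum.
Variables (R : realType) (d : nat) (Lab : finType).
Local Notation V := 'rV[R]_d.
Variable T : set (tile R d Lab).
Local Notation X := (hullSpace T).
Local Notation chi := (@chi R d Lab T).
Variable mu : probability X R.
Hypotheses (mu1 : mu (hull T : set X) = 1%E) (muinv : translation_invariant mu).

Lemma ae_hull (Pr : X -> Prop) : (forall S, hull T S -> Pr S) -> {ae mu, forall S, Pr S}.
Proof.
move=> H; apply: (@negligibleS _ _ _ mu (~` hull T)).
  by move=> S nP hS; apply: nP; exact: H.
apply/negligibleP; first by apply: measurableC; exact: hull_measurable.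
have E := probability_setC mu (@hull_measurable R d Lab T).
by rewrite mu1 subee// in E.
Qed.

(** Invariance makes the integral equal to its own negative; boundedness makes it finite, so it is
    0. *)
Lemma integral_antiperiodic (f : X -> R) x (c : R) : measurable_fun setT f ->
  (forall S, `|f S| <= c) ->
  (forall S, hull T S -> f (Defs.shift x S) = - f S) ->
  (\int[mu]_S (f S)%:E = 0)%E.
Proof.
move=> mf fc fx.
have integ (g : X -> R) : measurable_fun setT g -> (forall S, `|g S| <= c) ->
    mu.-integrable setT (EFin \o g).
  move=> mg gc; apply: (@le_integrable _ _ _ mu setT measurableT _ (EFin \o cst c)).
  - exact/measurable_EFinP.
  - by move=> S _ /=; rewrite lee_fin (le_trans (gc S))// ler_norm.
  - exact: finite_measure_integrable_cst.
have mfx : measurable_fun setT (f \o Defs.shift x).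
  by apply: measurableT_comp mf _; exact: measurable_shift.
have E1 : (\int[mu]_S (f (Defs.shift x S))%:E = \int[mu]_S (f S)%:E)%E.
  have := @integral_pushforward _ _ X X R (Defs.shift x) (measurable_shift x) mu
    setT (EFin \o f).
  rewrite preimage_setT => <- //.
  - apply: eq_measure_integral => [|mS A mA _]; first exact: measurable_shift.
    by rewrite -(muinv x mA).
  - exact/measurable_EFinP.
  - by apply: integ => // S; exact: fc.
have E2 : (\int[mu]_S (f (Defs.shift x S))%:E = - \int[mu]_S (f S)%:E)%E.
  transitivity (\int[mu]_S (- (f S)%:E))%E; last first.
    rewrite integralN//; exact: integrable_add_def (integ f mf fc).
  apply: ae_eq_integral => //.
  - exact/measurable_EFinP.
  - by apply/measurable_EFinP; exact: measurableT_comp.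
  - by apply: ae_hull => S hS _; rewrite fx.
have fin : (\int[mu]_S (f S)%:E)%E \is a fin_num.
  by exact: integrable_fin_num (integ f mf fc).
move: E1; rewrite E2; move: fin; case: (\int[mu]_S (f S)%:E)%E => //= r _ [rr].
by congr EFin; lra.
Qed.

Lemma expi_half : expi (- (2 * pi * 2^-1)) = -1 :> R[i].
Proof.
rewrite mulrAC divff// mul1r /expi cosN sinN cospi sinpi.
by apply/eqP; rewrite eq_complex /= !oppr0 !eqxx.
Qed.

Lemma integral_chi a : freq T a -> a != 0 ->
  (\int[mu]_S (complex.Re (chi a S))%:E = 0)%E /\
  (\int[mu]_S (complex.Im (chi a S))%:E = 0)%E.
Proof.
move=> fa a0; have aa : dotv a a != 0.
  apply: contra a0 => /eqP aa; rewrite -normr_eq0 -sqrf_eq0 eq_le sqr_ge0 andbT.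
  by rewrite -aa; exact: norm_le_sqnorm.
(* Chosen with [<x, a> = 1/2], so that translation by [x] multiplies the character by -1. *)
pose x := (2 * dotv a a)^-1 *: a.
have xa : dotv x a = 2^-1.
  rewrite /x /dotv (eq_bigr (fun i => (2 * dotv a a)^-1 * (a ord0 i * a ord0 i))).
    by rewrite -mulr_sumr -/(dotv a a) invfM mulrAC -mulrA divff// mulr1.
  by move=> i _; rewrite mxE mulrA.
have H (S : X) : hull T S -> chi a (Defs.shift x S) = - chi a S.
  by move=> hS; rewrite (chi_shift (T := T))// xa expi_half mulN1r.
split; apply: (@integral_antiperiodic _ x 1).
- exact: measurable_Re_chi.
- by move=> S; rewrite /chi /expi /= ler_norml cos_geN1 cos_le1.
- by move=> S /H ->; case: (chi a S).
- exact: measurable_Im_chi.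
- by move=> S; rewrite /chi /expi /= ler_norml sin_geN1 sin_le1.
- by move=> S /H ->; case: (chi a S).
Qed.

Lemma chi_eigenfunction a : freq T a -> eigenfunction mu a (chi a).
Proof.
move=> fa; split; [split; [|split]|split].
- exact: measurable_Re_chi.
- exact: measurable_Im_chi.
- under eq_integral do rewrite chi_cnorm2.
  by rewrite integral_cst// mul1e (le_lt_trans (probability_le1 _ _))// ltry.
- move=> [A [mA A0 HA]].
  have AT : A = setT.
    rewrite eqEsubset; split=> // S _; apply: HA => /= cS.
    have := @chi_cnorm2 R d Lab T a S; rewrite cS /cnorm2 /= expr0n addr0.
    by move=> /esym/eqP; rewrite oner_eq0.
  by have := probability_setT mu; rewrite -AT; move: A0 => -> /eqP; rewrite eqe eq_sym oner_eq0.
- move=> x; apply: ae_hull => S hS; rewrite (chi_shift (T := T))// dotvNl mulrN opprK.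
  by [].
Qed.

Lemma chi_inner a b : freq T a -> freq T b ->
  inner_re mu (chi a) (chi b) = (\int[mu]_S (complex.Re (chi (a - b) S))%:E)%E /\
  inner_im mu (chi a) (chi b) = (\int[mu]_S (complex.Im (chi (a - b) S))%:E)%E.
Proof.
move=> fa fb; have E S : chi a S * (chi b S)^*%C = chi (a - b) S.
  by rewrite chiD//; [rewrite chiN|exact: freqN].
by split; apply: eq_integral => S _; rewrite E.
Qed.

Lemma chi_pure_discrete :
  (forall A : set X, measurable A -> approx_set mu (@real_trig_poly R d Lab T) A) ->
  pure_discrete_spectrum mu.
Proof.
move=> HA; exists {a | freq T a}, (fun k => chi (sval k)); split.
- by move=> [a fa]; exists a; exact: chi_eigenfunction.
- move=> [a fa]; have [-> ->] := chi_inner fa fa; rewrite subrr; split.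
    rewrite (eq_integral (cst 1%E)) ?integral_cst ?mul1e//.
      exact: probability_setT.
    by move=> S _; rewrite chi0.
  by rewrite (eq_integral (cst 0%E)) ?integral0// => S _; rewrite chi0.
- move=> [a fa] [b fb] ab; have ab0 : a - b != 0.
    rewrite subr_eq0; apply/eqP => E; apply: ab; move: fa fb; rewrite E => fa fb.
    by congr exist; exact: Prop_irrelevance.
  have [H1 H2] := integral_chi (freqD fa (freqN fb)) ab0.
  by have [-> ->] := chi_inner fa fb.
move=> f [mr [mi fL2]] eps eps0.
have Alg_cst := @real_trig_cst R d Lab T.
have AlgD := @real_trigD R d Lab T.
have AlgM := @real_trigM R d Lab T.
have Alg_meas := @real_trig_measurable R d Lab T.
have Alg_bnd := @real_trig_bounded R d Lab T.
have ml : (forall g : X -> R, measurable_fun setT g ->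
    (forall S, (g S) ^+ 2 <= cnorm2 (f S)) -> (norm2 mu g < +oo)%E).
  move=> g mg gf; apply: le_lt_trans fL2; apply: ge0_le_integral => //.
  - by move=> S _; rewrite lee_fin sqr_ge0.
  - exact: measurable_sqr.
  - apply/measurable_EFinP; apply: measurable_funD; exact: measurable_funX.
  - by move=> S _; rewrite lee_fin.
(* [cnorm2] is the sum of the squares of the two parts, so real and imaginary parts are approximated
   separately, each with half the error. *)
have e2 : 0 < eps / 2 by rewrite divr_gt0.
have [|u tu fu] := approximable_L2 Alg_cst AlgD AlgM Alg_meas Alg_bnd HA mr _ e2.
  by apply: ml => // S; rewrite lerDl sqr_ge0.
have [|v tv fv] := approximable_L2 Alg_cst AlgD AlgM Alg_meas Alg_bnd HA mi _ e2.
  by apply: ml => // S; rewrite lerDr sqr_ge0.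
have [s Hs] := trig_polyD tu (trig_polyM (trig_poly_cst T (Complex 0 1)) tv).
exists (size s), (fun j => (tnth (in_tuple s) j).2), (fun j => (tnth (in_tuple s) j).1).
have E S : \sum_(j < size s) (tnth (in_tuple s) j).1 *
    chi (sval (tnth (in_tuple s) j).2) S = Complex (u S) (v S).
  have -> : Complex (u S) (v S) = (u S)%:C%C + Complex 0 1 * (v S)%:C%C.
    by congr Complex => /=; ring.
  by rewrite Hs [in RHS](big_tnth _ _ s).
under eq_integral => S _ do rewrite E.
have mu' := Alg_meas _ tu; have mv := Alg_meas _ tv.
have -> : (\int[mu]_S (cnorm2 (f S - Complex (u S) (v S)))%:E =
   norm2 mu (fun S => complex.Re (f S) - u S)%R +
   norm2 mu (fun S => complex.Im (f S) - v S)%R)%E.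
  rewrite /norm2 -ge0_integralD//; last 4 first.
  - by move=> S _; rewrite lee_fin sqr_ge0.
  - by apply: measurable_sqr; exact: measurable_funB.
  - by move=> S _; rewrite lee_fin sqr_ge0.
  - by apply: measurable_sqr; exact: measurable_funB.
  by apply: eq_integral => S _; rewrite -EFinD /cnorm2; case: (f S).
by rewrite (splitr eps) EFinD; apply: lteD.
Qed.

End Spectrum.

Theorem theorem4p8 (R : realType) (d : nat) (Lab : finType) (m : nat)
  (P : 'I_m -> tile R d Lab) (Q : 'M[R]_d) (omega : 'I_m -> set (tile R d Lab))
  (T : set (tile R d Lab)) (T0 : tile R d Lab) (L : set 'rV[R]_d) :
  subst_rule P Q omega -> primitive P omega -> subst_FLC P Q omega ->
  self_affine_tiling P Q omega T ->
  T T0 -> is_lattice L -> (forall v, L v -> T (tr T0 v)) ->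
  lin Q @` L `<=` L ->
  forall mu : probability (hullSpace T) R,
    mu (hull T : set (hullSpace T)) = 1%E ->
    translation_invariant mu ->
    pure_discrete_spectrum mu.
Proof.
move=> substP primP _ saT TT0 lL TL QL mu mu1 muinv.
have gT := good_T saT.
have [r r0 thT] := T_thick substP primP saT.
have [c bT0] : exists c, forall z, tsupp T0 z -> `|z| <= c.
  have [c _ Hc] := prototile_bounded substP.
  have [i [x ->]] := T_translate saT TT0; exists (c + `|x|) => z /mem_tr/Hc zc.
  by rewrite -(subrK x z) (le_trans (ler_normD _ _))// lerD2r.
have lLn n : is_lattice (latt Q L n) by exact: latt_lattice substP lL n.
have PT0 n : Per T (latt Q L n) T0.
  by rewrite -(tr0 T0); apply: Per_T0 => //; exact: lattice0.
have lM n := period_lattice gT (lLn n) (PT0 n) r0 (thT _ TT0) bT0.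
apply: chi_pure_discrete => // A mA.
apply: (@Aset_measurable _ _ _ T (latt Q L)) => // [n|n|s eps e0].
- split; first exact: lattice0.
  by move=> x y Mx My; exact: latticeD (lM n) Mx (latticeN (lM n) My).
- apply: (period_recognizable gT (lLn n) (PT0 n) r0 (thT _ TT0) bT0).
  + exact: T_nonempty substP primP saT.
  + exact: T_finite substP primP saT.
  + exact: T_repetitive saT.
exact: (density_bad substP primP saT TT0 lL TL QL s e0).
Qed.
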